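(* Let $n\geqslant 3$ be an integer. For a pair of bidirectional carousels operated under the ''shortest single direction after the nearest item'' strategy, the distribution function $F_S$ of the steady-state sojourn time $S$ of the picker satisfies, for $0\leqslant x\leqslant 1$, the integral equation \begin{align*} F_S(x)&=F_A(x)-\int_{(2x-1)^+}^x\int_0^{\frac{1+y}{2}-x}2n(n-1)y^{n-2}F_S(z)\,dz\,dy\\ &\quad-\int_{\max\{(x-\frac{1}{4})^+,\,2x-1\}}^{x}\int_0^{\min\{\frac{1}{4}+y-x,\,\frac{1+y}{2}-x\}}2n(n-1)\left((3y-2x-2z)^+\right)^{n-2}F_S(z)\,dz\,dy\\ &\quad+\int_{\max\{\frac{1}{2},\,2x-1\}}^{\max\{\frac{1}{2},\,x\}}\int_0^{\frac{1+y}{2}-x}4n(n-1)(2y-1)^{n-2}F_S(z)\,dz\,dy, \end{align*} where $F_A$ is the distribution function of the pick time $A$.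
   Context: Model. A carousel is a circle of length $1$ rotating at unit speed. Each order consists of $n$ items whose positions are independent and uniformly distributed on the circle. One picker alternates between two carousels, picking one order at each visit; switching and item-removal times are ignored. For an order, the preparation time $B$ is the rotation time from the carousel's current position (the origin) to the first item to be picked, and the pick (travel) time $A$ is the rotation time needed, after the first item is reached, to visit the remaining $n-1$ items. Strategy considered. The carousel first moves to the item nearest to the origin (in either direction), so $B$ is the distance to the nearest item. From that item, all remaining items are collected either all clockwise or all counter-clockwise, whichever is shorter; $A$ is the smaller of the two corresponding travel distances. Equivalently, $A=1-\max\{C,D\}$, where $C$ and $D$ are the distances along the circle from the nearest item to the next item in each of the two directions. The distribution function of $A$ is, for $0\leqslant y\leqslant 1$, $$F_A(y)=2y^n+ny^{n-1}(1-y)-((2y-1)^+)^n-n((2y-1)^+)^{n-1}(1-y).$$ Sojourn time. The sojourn times of successive orders satisfy $S_{k+1}=(B_{k+1}-S_k)^++A_{k+1}$, $S_1=B_1+A_1$, where the pairs $(A_k,B_k)$ are i.i.d. copies of $(A,B)$ and $u^+=\max\{0,u\}$. $S$ is distributed according to the (unique) limiting distribution of $S_k$ as $k\to\infty$, so that $S\stackrel{\mathcal{D}}{=}(B-S)^++A$ with $S$ on the right-hand side independent of $(A,B)$. It is assumed that $0\leqslant S\leqslant 1$ (so $F_S(1)=1$), $F_S(0)=0$ and that $S$ has a density. *)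

(* Defs.v *)
From HB Require Import structures.
From mathcomp Require Import all_boot all_order all_algebra.
From mathcomp Require Import all_classical all_reals all_analysis.

Set Implicit Arguments.
Unset Strict Implicit.
Unset Printing Implicit Defensive.

Import Order.TTheory GRing.Theory Num.Theory.
Import numFieldNormedType.Exports.

Local Open Scope classical_set_scope.
Local Open Scope ring_scope.

Definition pos_part (R : realType) (u : R) : R := Num.max 0 u.

(* Points of the circle of length 1 are represented by real numbers modulo 1;
   the origin, i.e. the current position of the carousel, is 0. *)

Definition frac_part (R : realType) (t : R) : R := t - (Num.floor t)%:~R.

(* Length of the clockwise arc from p to q; the counter-clockwise arc from p
   to q has length cw_dist q p. *)
Definition cw_dist (R : realType) (p q : R) : R := frac_part (q - p).

Definition circle_dist (R : realType) (p q : R) : R :=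
  Num.min (cw_dist p q) (cw_dist q p).

(* This is never None when 0 < n.  Under independent uniform positions ties
   have probability 0. *)
Definition nearest_item (R : realType) (n : nat) (x : 'I_n -> R) :
    option 'I_n :=
  [pick i | [forall j, circle_dist 0 (x i) <= circle_dist 0 (x j)]].

Definition preparation_time (R : realType) (n : nat) (x : 'I_n -> R) : R :=
  if nearest_item x is Some i then circle_dist 0 (x i) else 0.

(* Sweeping from the nearest item i in a fixed direction until every remaining
   item has been reached takes the largest of the arc lengths, in that
   direction, from i to the remaining items. *)
Definition pick_time (R : realType) (n : nat) (x : 'I_n -> R) : R :=
  if nearest_item x is Some i then
    Num.min (\big[Num.max/0]_(j | j != i) cw_dist (x i) (x j))
            (\big[Num.max/0]_(j | j != i) cw_dist (x j) (x i))
  else 0.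

(* Mutual independence: the product rule over every finite subfamily. *)
Definition mutually_independent (I : choiceType) (R : realType)
    (d d' : measure_display) (T : measurableType d) (T' : measurableType d')
    (P : probability T R) (X : I -> {RV P >-> T'}) : Prop :=
  forall (J : seq I) (E : I -> set T'), uniq J ->
    (forall i, measurable (E i)) ->
    P (\bigcap_(i in [set` J]) (X i @^-1` E i)) =
    (\prod_(i <- J) P (X i @^-1` E i))%E.

Definition uniform_on_circle (R : realType) (d : measure_display)
    (T : measurableType d) (P : probability T R) (X : {RV P >-> R}) : Prop :=
  forall E : set R, measurable E ->
    distribution P X E = uniform_prob (@ltr01 R) E.

Definition distr_fun (R : realType) (d : measure_display)
    (T : measurableType d) (P : probability T R) (X : {RV P >-> R}) (x : R) : R :=
  fine (cdf X x).

Definition has_density (R : realType) (d : measure_display)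
    (T : measurableType d) (P : probability T R) (X : {RV P >-> R}) : Prop :=
  exists f : R -> R,
    [/\ measurable_fun setT f, (forall r, 0 <= f r) &
        forall E : set R, measurable E ->
          distribution P X E = (\int[lebesgue_measure]_(r in E) (f r)%:E)%E].

Definition cvg_in_distribution (R : realType) (d d' : measure_display)
    (T : measurableType d) (T' : measurableType d')
    (P : probability T R) (Q : probability T' R)
    (Xs : nat -> {RV P >-> R}) (X : {RV Q >-> R}) : Prop :=
  forall x : R, {for x, continuous (distr_fun X)} ->
    distr_fun (Xs k) x @[k --> \oo] --> distr_fun X x.

(* Main.v *)
(** Given that the nearest item is at distance b from the origin, the other
    n - 1 items are uniform on the arc of length 1 - 2 b facing the origin, and
    A <= y means that all of them can be swept from the nearest item within
    distance y in at least one direction.  Inclusion-exclusion gives the law of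
    (A, B): on 0 <= b, 0 <= a <= 1 - 2 b it has the density
      2 n (n - 1) (a^(n-2) + ((a - 2 b)^+)^(n-2) - 2 ((2 a - 1)^+)^(n-2)).
    Since S_k is independent of the next order, letting k go to infinity in the
    recursion yields F_S(x) = F_A(x) - E[1_{A <= x} F_S(A + B - x)].  In this
    expectation the substitution z = a + b - x turns the three terms of the
    density into the three double integrals. *)
Require Import Defs.
From HB Require Import structures.
From mathcomp Require Import all_boot all_order all_algebra.
From mathcomp Require Import all_classical all_reals all_analysis.
From mathcomp Require Import measurable_realfun.
From mathcomp Require Import ring lra.

Import Order.TTheory GRing.Theory Num.Theory.
Import numFieldNormedType.Exports.

Local Open Scope classical_set_scope.
Local Open Scope ring_scope.


(** * Measures and integrals *)

(** Independence of [S_k] from the next order is itself proved by induction, and the induction must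
    keep all later orders, since each step consumes one. The density of [S] makes [F_S] continuous,
    so convergence in distribution is usable at every point; it also bridges the gap to
    [P(S_k < t)], which is not a value of a distribution function. Nothing is conditioned on a null
    event: each item is tried as the nearest, its position is frozen, the other items contribute
    powers of section measures, and ties form a null set. In the factor [2 n (n - 1)], [n] counts
    the choice of the nearest item, 2 its two possible positions at distance [b], and [n - 1] comes
    from differentiating a power. For [n >= 3] the powers of positive parts have exponent at least 1
    and vanish off their natural region, which reconciles the different limits of the three
    integrals with one common region. The constant 1/4 is the largest [b] with
    [2 b <= a <= 1 - 2 b]. Identities with a negative term are proved as equalities between sums of
    nonnegative integrals; subtraction comes only after finiteness. *)

Section density_measure.
Local Open Scope ereal_scope.
Context {d} {T : measurableType d} {R : realType}.
Variables (mu : {measure set T -> \bar R}) (f : T -> R).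
Hypothesis mf : measurable_fun [set: T] f.
Hypothesis f0 : forall x, (0 <= f x)%R.

(** The proofs of measurability and positivity are arguments, so that the measure instance below can
    be inferred from the term itself. *)
Definition density_measure of measurable_fun [set: T] f & (forall x, 0 <= f x)%R :=
  fun U : set T => \int[mu]_(x in U) (f x)%:E.

Local Notation nu := (density_measure mf f0).

Let density0 : nu set0 = 0.
Proof. exact: integral_set0. Qed.

Let density_ge0 U : 0 <= nu U.
Proof. by apply: integral_ge0 => x _; rewrite lee_fin. Qed.

Let density_sigma_additive : semi_sigma_additive nu.
Proof.
move=> /= F mF tF mUF; rewrite /density_measure; apply: cvg_toP.
  apply: ereal_nondecreasing_is_cvgn => m n mn.
  apply: lee_sum_nneg_natr => // k _ _.
  by apply: integral_ge0 => x _; rewrite lee_fin.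
rewrite ge0_integral_bigcup//.
- by apply/measurable_EFinP; exact: measurable_funTS.
- by move=> x _; rewrite lee_fin.
Qed.

HB.instance Definition _ := isMeasure.Build _ _ _ nu
  density0 density_ge0 density_sigma_additive.

Import HBNNSimple.

Lemma ge0_integral_density_measure (g : T -> \bar R) :
  measurable_fun [set: T] g -> (forall x, 0 <= g x) ->
  \int[nu]_x g x = \int[mu]_x (g x * (f x)%:E).
Proof.
move=> mg g0; pose g_ := nnsfun_approx measurableT mg.
have mEf : measurable_fun setT (EFin \o f) by exact/measurable_EFinP.
have g_0 n x : 0 <= (g_ n x)%:E by rewrite lee_fin.
have mg_ n : measurable_fun setT (EFin \o g_ n).
  by apply/measurable_EFinP; exact: measurable_funTS.
transitivity (limn (fun n => \int[nu]_x (g_ n x)%:E)).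
  rewrite -monotone_convergence//.
  - by apply: eq_integral => y _; apply/esym/cvg_lim => //; exact: cvg_nnsfun_approx.
  - by move=> x _ m n mn; rewrite lee_fin; exact/lefP/nd_nnsfun_approx.
transitivity (limn (fun n => \int[mu]_x ((g_ n x)%:E * (f x)%:E))); last first.
  rewrite -monotone_convergence//.
  - apply: eq_integral => y _; apply/cvg_lim => //.
    by apply: cvgeZr => //; exact: cvg_nnsfun_approx.
  - by move=> n; apply: emeasurable_funM => //; exact: mg_.
  - by move=> n x _; rewrite mule_ge0// lee_fin.
  - move=> x _ m n mn; rewrite lee_wpmul2r// lee_fin//.
    exact/lefP/nd_nnsfun_approx.
congr (limn _); apply/funext => n.
(* For a simple function the integral against [nu] is a finite sum of values times masses, and each
   mass is an integral of [f]. *)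
transitivity (\sum_(r \in range (g_ n)) (r%:E * nu (g_ n @^-1` [set r]))).
  by rewrite integralT_nnsfun sintegralE.
under [RHS]eq_integral => x _.
  rewrite fimfunE -fsumEFin// ge0_mule_fsuml//; last first.
    by move=> r; rewrite lee_fin; exact: nnfun_muleindic_ge0.
  over.
rewrite ge0_integral_fsum//; last 2 first.
- move=> r; apply: emeasurable_funM => //.
  exact/measurable_EFinP/measurable_funM.
- by move=> r x _; apply: mule_ge0; rewrite ?EFinM ?nnfun_muleindic_ge0 ?lee_fin.
apply: eq_fsbigr => r /[!inE] -[z _ grz].
have r0 : (0 <= r)%R by rewrite -grz.
rewrite /density_measure integral_mkcond -ge0_integralZl//; last 2 first.
- exact/(measurable_restrictT (EFin \o f) _).1/measurable_funTS.
- by move=> x _; rewrite patchE; case: ifPn; rewrite ?lee_fin.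
apply: eq_integral => x _; rewrite patchE indicE EFinM.
by case: ifPn => _; rewrite ?mule1 ?mule0 ?mul0e.
Qed.

End density_measure.

(** * Invariance of Lebesgue measure under translation and reflection *)

Section lebesgue_measure_preserving.
Local Open Scope ereal_scope.
Context {R : realType}.
Variables (phi : measurableTypeR R -> measurableTypeR R) (f : R -> \bar R).
Hypothesis mphi : measurable_fun setT phi.
Hypothesis phiE : forall a b : R,
  lebesgue_measure (phi @^-1` `]a, b]) = lebesgue_measure `]a, b]%classic.
Hypotheses (mf : measurable_fun setT f) (f0 : forall r, 0 <= f r).

(** Half-open intervals determine Lebesgue measure, so [phiE] identifies the pushforward by [phi]
    with it. *)
Lemma ge0_integral_measure_preserving :
  \int[lebesgue_measure]_x f (phi x) = \int[lebesgue_measure]_x f x.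
Proof.
transitivity (\int[pushforward lebesgue_measure phi]_x f x).
  by rewrite ge0_integral_pushforward// => ? _; exact: f0.
apply: eq_measure_integral => A mA _.
have := @lebesgue_measure_unique R (pushforward lebesgue_measure phi).
by move=> /(_ mphi) h; apply/esym/h => // _ [[a b] _ <-]; exact/esym/phiE.
Qed.

End lebesgue_measure_preserving.

Lemma ge0_integral_shift (R : realType) (c : R) (f : R -> \bar R) :
  measurable_fun setT f -> (forall r, 0 <= f r)%E ->
  (\int[lebesgue_measure]_x f (x + c)%R = \int[lebesgue_measure]_x f x)%E.
Proof.
move=> mf f0; apply: (ge0_integral_measure_preserving (fun x => x + c)) => //.
  exact: measurable_funD.
move=> a b; rewrite (_ : _ @^-1` _ = `]a - c, b - c]%classic).
  rewrite !lebesgue_measure_itv/= !lte_fin ltrD2r; case: ifPn => // _.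
  by rewrite -!EFinB; congr (_ %:E)%E; lra.
by apply/seteqP; split => z /=; rewrite !in_itv/= => /andP[? ?];
  apply/andP; split; lra.
Qed.

Lemma ge0_integral_onem (R : realType) (f : R -> \bar R) :
  measurable_fun setT f -> (forall r, 0 <= f r)%E ->
  (\int[lebesgue_measure]_x f (1 - x)%R = \int[lebesgue_measure]_x f x)%E.
Proof.
move=> mf f0; apply: (ge0_integral_measure_preserving (fun x => 1 - x)) => //.
  exact: measurable_funB.
move=> a b; rewrite (_ : _ @^-1` _ = `[1 - b, 1 - a[%classic).
  rewrite !lebesgue_measure_itv/= !lte_fin ltrD2l ltrN2; case: ifPn => // _.
  by rewrite -!EFinB; congr (_ %:E)%E; lra.
by apply/seteqP; split => z /=; rewrite !in_itv/= => /andP[? ?];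
  apply/andP; split; lra.
Qed.

Section measures_on_R.
Local Open Scope ereal_scope.
Context {R : realType}.

(* [lebesgue_measure] and [uniform_prob] live on [measurableTypeR R], which has
   the same measurable sets as [R] but another display; these copies on [R] can
   be combined with laws of random variables on [R * R]. *)
Definition lebR (E : set R) : \bar R := lebesgue_measure (E : set (measurableTypeR R)).

Let lebR0 : lebR set0 = 0. Proof. exact: measure0. Qed.

Let lebR_ge0 E : 0 <= lebR E. Proof. exact: measure_ge0. Qed.

Let lebR_sigma_additive : semi_sigma_additive lebR.
Proof. exact: (@measure_semi_sigma_additive _ _ _ (@lebesgue_measure R)). Qed.

HB.instance Definition _ := isMeasure.Build _ _ _ lebR
  lebR0 lebR_ge0 lebR_sigma_additive.

Let lebR_sigma_finite : sigma_finite setT lebR.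
Proof. exact: (sigma_finiteT (@lebesgue_measure R)). Qed.

HB.instance Definition _ := Measure_isSigmaFinite.Build _ _ _ lebR lebR_sigma_finite.

Lemma ge0_integral_lebR (D : set R) (f : R -> \bar R) :
  measurable D -> measurable_fun D f -> (forall x, D x -> 0 <= f x) ->
  \int[lebR]_(x in D) f x = \int[lebesgue_measure]_(x in D) f x.
Proof.
move=> mD mf f0.
have mid : measurable_fun setT (id : measurableTypeR R -> R) by [].
transitivity (\int[pushforward lebesgue_measure (id : measurableTypeR R -> R)]_(x in D) f x).
  by apply: eq_measure_integral.
by rewrite ge0_integral_pushforward// => y; rewrite inE; exact: f0.
Qed.

Definition unif01 (E : set R) : \bar R :=
  uniform_prob (@ltr01 R) (E : set (measurableTypeR R)).

Let unif010 : unif01 set0 = 0. Proof. exact: measure0. Qed.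

Let unif01_ge0 E : 0 <= unif01 E. Proof. exact: measure_ge0. Qed.

Let unif01_sigma_additive : semi_sigma_additive unif01.
Proof. exact: (@measure_semi_sigma_additive _ _ _ (uniform_prob (@ltr01 R))). Qed.

HB.instance Definition _ := isMeasure.Build _ _ _ unif01
  unif010 unif01_ge0 unif01_sigma_additive.

Let unif01_setT : unif01 setT = 1.
Proof. exact: (@probability_setT _ _ _ (uniform_prob (@ltr01 R))). Qed.

HB.instance Definition _ := Measure_isProbability.Build _ _ _ unif01 unif01_setT.

Lemma unif01E (E : set R) : measurable E -> unif01 E = lebR (E `&` `[0%R, 1%R]).
Proof.
move=> mE; rewrite /unif01 /uniform_prob integral_uniform_pdf.
rewrite (eq_integral (fun=> 1)); last first.
  move=> t; rewrite inE => -[_] /=; rewrite in_itv/= /uniform_pdf => ->.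
  by rewrite subr0 invr1.
by rewrite integral_cst ?mul1e//; exact: measurableI.
Qed.

Lemma ge0_integral_unif01 (f : R -> \bar R) :
  measurable_fun setT f -> (forall x, 0 <= f x) ->
  \int[unif01]_x f x = \int[lebR]_(x in `[0%R, 1%R]) f x.
Proof.
move=> mf f0.
have mid : measurable_fun setT (id : measurableTypeR R -> R) by [].
transitivity (\int[pushforward (uniform_prob (@ltr01 R)) (id : measurableTypeR R -> R)]_x f x).
  by apply: eq_measure_integral.
rewrite ge0_integral_pushforward//.
rewrite integral_uniform// subr0 invr1 mul1e ge0_integral_lebR//.
exact: measurable_funTS.
Qed.

Lemma lebR_shift (c : R) (f : R -> \bar R) :
  measurable_fun setT f -> (forall r, 0 <= f r) ->
  \int[lebR]_x f (x + c)%R = \int[lebR]_x f x.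
Proof.
move=> mf f0; rewrite !ge0_integral_lebR//; first exact: ge0_integral_shift.
by apply: measurableT_comp => //; exact: measurable_funD.
Qed.

Lemma lebR_onem (f : R -> \bar R) :
  measurable_fun setT f -> (forall r, 0 <= f r) ->
  \int[lebR]_x f (1 - x)%R = \int[lebR]_x f x.
Proof.
move=> mf f0; rewrite !ge0_integral_lebR//; first exact: ge0_integral_onem.
by apply: measurableT_comp => //; exact: measurable_funB.
Qed.

End measures_on_R.

(** * Measures determined by rectangles *)

Section rectangles.
Context {d1 d2} {T1 : measurableType d1} {T2 : measurableType d2} {R : realType}.

Lemma eq_measure_rectangle (m1 m2 : {measure set (T1 * T2) -> \bar R}) :
  (m1 setT < +oo)%E ->
  (forall A B, measurable A -> measurable B -> m1 (A `*` B) = m2 (A `*` B)) ->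
  forall X, measurable X -> m1 X = m2 X.
Proof.
move=> m1oo m12 X mX.
pose C : set (set (T1 * T2)) :=
  [set C | exists A B, [/\ measurable A, measurable B & C = A `*` B]].
apply: (measure_unique C (fun=> setT)) => //.
- rewrite measurable_prod_measurableType //; congr (<<s _ >>).
  apply/seteqP; split => [_ [A mA [B mB <-]]|_ [A [B [mA mB ->]]]].
    by exists A, B.
  by exists A => //; exists B.
- move=> _ _ [A1 [B1 [mA1 mB1 ->]]] [A2 [B2 [mA2 mB2 ->]]].
  by exists (A1 `&` A2), (B1 `&` B2); rewrite setXI; split => //; exact: measurableI.
- by move=> _; exists setT, setT; rewrite setXTT.
- by apply/seteqP; split => // x _; exists 0%N.
- by move=> _ [A [B [mA mB ->]]]; exact: m12.
Qed.

End rectangles.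

(** * Independence *)

Section sections.
Local Open Scope ereal_scope.
Context {d d0 d1} {T : measurableType d} {T0 : measurableType d0}
  {T1 : measurableType d1} {R : realType}.
Variables (P : probability T R) (Q0 : probability T0 R) (Q : probability T1 R).
Variables (I : eqType) (Y : {RV P >-> T0}) (X : I -> {RV P >-> T1}).

Lemma measurable_forall_seq (J : seq I) (A : I -> set T) :
  (forall i, measurable (A i)) ->
  measurable [set w | forall i, i \in J -> A i w].
Proof.
move=> mA; elim: J => [|j J IH].
  by rewrite (_ : [set _ | _] = setT)//; apply/seteqP; split.
rewrite (_ : [set _ | _] = A j `&` [set w | forall i, i \in J -> A i w]).
  exact: measurableI.
apply/seteqP; split => w /=.
  move=> h; split; first by apply: h; rewrite mem_head.
  by move=> i iJ; apply: h; rewrite inE iJ orbT.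
by move=> [Aj h] i; rewrite inE => /orP[/eqP->//|/h].
Qed.

Lemma measurable_fun_prob_xsection (G : set (T0 * T1)) : measurable G ->
  measurable_fun setT (fun t => fine (Q (xsection G t))).
Proof.
move=> mG; apply/measurable_EFinP.
rewrite (_ : _ \o _ = Q \o xsection G); first exact: measurable_fun_xsection.
by apply/funext => t /=; rewrite fineK// fin_num_measure//; exact: measurable_xsection.
Qed.

(* The independent event [K] is there for the induction on [J]: it absorbs an
   event [X j @^-1` E] when [j] is removed from [J]. *)
Lemma probability_sections (J : seq I) (G : I -> set (T0 * T1)) (K : set T) :
  uniq J -> measurable K -> (forall i, measurable (G i)) ->
  (forall D E, measurable D -> (forall i, measurable (E i)) ->
    P [set w | [/\ D (Y w), (forall i, i \in J -> E i (X i w)) & K w]] =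
    Q0 D * (\prod_(i <- J) Q (E i)) * P K) ->
  forall D, measurable D ->
    P [set w | [/\ D (Y w), (forall i, i \in J -> G i (Y w, X i w)) & K w]] =
    (\int[Q0]_(t in D) (\prod_(i <- J) fine (Q (xsection (G i) t)))%:E) * P K.
Proof.
move=> + + mG; elim: J K => [|j J IH] K /= uJ mK h D mD.
  have := h D (fun=> setT) mD (fun=> measurableT).
  rewrite !big_nil mule1 => h0.
  under eq_integral do rewrite big_nil.
  rewrite integral_cst// mul1e -h0; congr (P _).
  by apply/seteqP; split => w [].
move: uJ => /andP[jJ uJ].
pose f t := (\prod_(i <- J) fine (Q (xsection (G i) t)))%R.
have f0 t : (0 <= f t)%R by apply: prodr_ge0 => i _; exact: fine_ge0.
have mf : measurable_fun setT f.
  by apply: measurable_prod => i _; exact: measurable_fun_prob_xsection.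
pose p := fine (P K).
have p0 : (0 <= p)%R by exact: fine_ge0.
have PKE : P K = p%:E by rewrite fineK// fin_num_measure.
pose g (z : T0 * T1) := (f z.1 * p)%R.
have mg : measurable_fun setT g.
  by apply: measurable_funM => //; apply: measurableT_comp => //; exact: measurable_fst.
have g0 z : (0 <= g z)%R by exact: mulr_ge0.
pose W := [set w | (forall i, i \in J -> G i (Y w, X i w)) /\ K w].
have mYX i : measurable_fun setT (fun w => (Y w, X i w)).
  exact: measurable_fun_pair.
have mW : measurable W.
  apply: measurableI => //.
  apply: (measurable_forall_seq _ (fun i => [set w | G i (Y w, X i w)])) => i.
  by rewrite -[X in measurable X]setTI; exact: mYX.
(* The product rule with [D] and every event of an index other than [j] taken to be the whole
   space. *)
have ind E : measurable E -> P (X j @^-1` E `&` K) = Q E * P K.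
  move=> mE; have := h setT (fun i => if i == j then E else setT) measurableT.
  rewrite probability_setT mul1e big_cons eqxx big1_seq ?mule1.
    move=> <-; last by move=> i; case: ifP.
    congr (P _); apply/seteqP; split => w /=.
      by move=> [Ej Kw]; split => // i _; case: ifPn => // /eqP ->.
    by move=> [_ /(_ j)]; rewrite eqxx mem_head => Ej Kw; split => //; exact: Ej.
  move=> i /andP[_ iJ]; case: eqP => [ij|_]; last by rewrite probability_setT.
  by move: jJ; rewrite -ij iJ.
have IHj A E : measurable A -> measurable E ->
    P [set w | [/\ A (Y w), (forall i, i \in J -> G i (Y w, X i w)) & X j w \in E /\ K w]] =
    (\int[Q0]_(t in A) (f t)%:E) * (Q E * P K).
  move=> mA mE.
  rewrite -ind// -(IH (X j @^-1` E `&` K) uJ)//.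
  - congr (P _); apply/seteqP.
    by split => w /= []; rewrite inE.
  - by apply: measurableI => //; exact: measurable_funPTI.
  - move=> D' E' mD' mE'.
    have := h D' (fun i => if i == j then E else E' i) mD'.
    rewrite big_cons eqxx ind// => h'.
    transitivity (Q0 D' * (Q E * \prod_(i <- J) Q (E' i)) * P K); last first.
      by rewrite -!muleA; congr (_ * _); rewrite muleCA !muleA.
    rewrite [X in Q E * X](eq_big_seq (fun i => Q (if i == j then E else E' i))); last first.
      by move=> i iJ; case: eqP => // ij; move: jJ; rewrite -ij iJ.
    rewrite -h'; last by move=> i; case: ifP.
    congr (P _); apply/seteqP; split => w /=.
      move=> [Dw Jw [Ew Kw]]; split => // i; rewrite inE.
      by case: eqP => [->//|/= _]; exact: Jw.
    move=> [Dw Jw Kw]; split => //.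
      move=> i iJ; have := Jw i; rewrite inE iJ orbT => /(_ erefl).
      by case: eqP => // ij; move: jJ; rewrite -ij iJ.
    by split => //; have := Jw j; rewrite mem_head eqxx; exact.
(* Restricting [P] to [W] builds in the constraints of [J] and [K]. The claim is that [(Y, X j)]
   then has density [g] with respect to the product measure; on rectangles this is [IHj], and
   rectangles suffice. *)
pose m1 := pushforward (mrestr P mW) (fun w => (Y w, X j w)).
pose m2 := density_measure (Q0 \x Q) g mg g0.
have m2E H : measurable H ->
    m2 H = \int[Q0]_x ((f x)%:E * Q (xsection H x)) * P K.
  move=> mH; rewrite /m2 /density_measure integral_mkcond fubini_tonelli1/=; last 2 first.
  - have mEg : measurable_fun setT (EFin \o g) by exact/measurable_EFinP.
    exact: (measurable_restrictT (EFin \o g) mH).1 (measurable_funTS mEg).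
  - by move=> z; rewrite patchE; case: ifPn; rewrite ?lee_fin.
  rewrite PKE muleC -ge0_integralZl//; last 2 first.
  - apply: emeasurable_funM; first exact/measurable_EFinP.
    exact: measurable_fun_xsection.
  - by move=> t _; rewrite mule_ge0 ?lee_fin.
  apply: eq_integral => t _; rewrite /fubini_F.
  transitivity (\int[Q]_(y in xsection H t) (f t * p)%:E).
    rewrite [RHS]integral_mkcond; apply: eq_integral => y _.
    by rewrite !patchE mem_xsection.
  rewrite integral_cst//; last exact: measurable_xsection.
  by rewrite EFinM muleA (muleC p%:E).
have m12 H : measurable H -> m1 H = m2 H.
  apply: eq_measure_rectangle.
    rewrite /m1/= /pushforward /mrestr preimage_setT setTI.
    by rewrite (le_lt_trans (probability_le1 _ _))// ltry.
  move=> A E mA mE; rewrite [RHS]m2E; last exact: measurableX.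
  transitivity (\int[Q0]_(x in A) ((f x)%:E * Q E) * P K); last first.
    congr (_ * _); rewrite integral_mkcond; apply: eq_integral => t _.
    rewrite patchE; case: ifPn => tA; first by rewrite in_xsectionX.
    by rewrite notin_xsectionX// measure0 mule0.
  rewrite ge0_integralZr//; last 2 first.
  - exact/measurable_EFinP/measurable_funTS.
  - by move=> t _; rewrite lee_fin.
  rewrite -muleA -(IHj _ _ mA mE) /m1 /= /pushforward /mrestr; congr (P _).
  apply/seteqP; split => w /=; first by move=> [[? ?] [? ?]]; split => //; rewrite inE.
  by rewrite inE => -[? ? [? ?]].
have mHG : measurable (G j `&` (D `*` setT)).
  by apply: measurableI => //; exact: measurableX.
transitivity (m1 (G j `&` (D `*` setT))).
  rewrite /m1 /= /pushforward /mrestr; congr (P _).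
  apply/seteqP; split => w /=.
    move=> [Dw Jw Kw]; split; first by split=> //; apply: Jw; rewrite mem_head.
    by split => // i iJ; apply: Jw; rewrite inE iJ orbT.
  move=> [[Gw [Dw _]] [Jw Kw]]; split => // i; rewrite inE => /orP[/eqP->//|].
  exact: Jw.
rewrite m12// m2E//; congr (_ * _).
rewrite [RHS]integral_mkcond; apply: eq_integral => t _.
rewrite patchE xsectionI; case: ifPn => tD.
  rewrite in_xsectionX// setIT big_cons mulrC EFinM fineK//.
  by rewrite fin_num_measure//; exact: measurable_xsection.
by rewrite notin_xsectionX// setI0 measure0 mule0.
Qed.
End sections.

(** * Independence of the recursive state from later inputs *)

Section recursion.
Local Open Scope ereal_scope.
Context {d d0 d1} {T : measurableType d} {T0 : measurableType d0}
  {T1 : measurableType d1} {R : realType}.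
Variables (P : probability T R) (V : nat -> {RV P >-> T1}) (Z : nat -> {RV P >-> T0}).
Variables (h0 : T1 -> T0) (h : T0 * T1 -> T0).
Hypothesis V_indep : mutually_independent V.
Hypotheses (mh0 : measurable_fun setT h0) (mh : measurable_fun setT h).
Hypothesis Z_init : forall w, Z 0%N w = h0 (V 0%N w).
Hypothesis Z_rec : forall k w, Z k.+1 w = h (Z k w, V k.+1 w).

Let joint k (J : seq nat) (D : set T0) (E : nat -> set T1) :=
  [set w | D (Z k w) /\ forall i, i \in J -> E i (V i w)].

Let joint_nil k D E : joint k [::] D E = Z k @^-1` D.
Proof. by apply/seteqP; split => w; [case|split]. Qed.

(** The assumed product rule covers rectangles in [(Z k, V k.+1)]. Freezing the events of [J] as a
    restriction of [P] leaves a measure on pairs, so uniqueness extends the rule to every measurable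
    [H]. *)
Let joint_step k (J : seq nat) :
  uniq (k.+1 :: J) ->
  (forall D E, measurable D -> (forall i, measurable (E i)) ->
    P (joint k (k.+1 :: J) D E) =
    P (Z k @^-1` D) * \prod_(i <- k.+1 :: J) P (V i @^-1` E i)) ->
  forall H E, measurable H -> (forall i, measurable (E i)) ->
  P [set w | H (Z k w, V k.+1 w) /\ forall i, i \in J -> E i (V i w)] =
  (distribution P (Z k) \x distribution P (V k.+1))%E H *
  \prod_(i <- J) P (V i @^-1` E i).
Proof.
move=> /= /andP[kJ uJ] IH H E mH mE.
pose K := [set w | forall i, i \in J -> E i (V i w)].
have mK : measurable K.
  apply: (@measurable_forall_seq _ _ _ J (fun i => V i @^-1` E i)) => i.
  exact: measurable_funPTI.
have prodE A : measurable A -> forall B, measurable B ->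
    P (Z k @^-1` A `&` V k.+1 @^-1` B `&` K) =
    P (Z k @^-1` A) * P (V k.+1 @^-1` B) * \prod_(i <- J) P (V i @^-1` E i).
  move=> mA B mB.
  have := IH A (fun i => if i == k.+1 then B else E i) mA.
  rewrite big_cons eqxx => IH'.
  rewrite (eq_big_seq (fun i => P (V i @^-1` (if i == k.+1 then B else E i)))); last first.
    by move=> i iJ; case: eqP => // ij; move: kJ; rewrite -ij iJ.
  rewrite -muleA -IH'; last by move=> i; case: ifP.
  congr (P _); apply/seteqP; split => w /=.
    move=> [[Aw Bw] Kw]; split => // i; rewrite inE.
    by case: eqP => [->//|/= _]; exact: Kw.
  move=> [Aw Kw]; split; first by split => //; have := Kw k.+1; rewrite mem_head eqxx; exact.
  move=> i iJ; have := Kw i; rewrite inE iJ orbT => /(_ erefl).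
  by case: eqP => // ij; move: kJ; rewrite -ij iJ.
have PK : P K = \prod_(i <- J) P (V i @^-1` E i).
  have := prodE setT measurableT setT measurableT.
  by rewrite !preimage_setT !probability_setT !setTI !mul1e.
rewrite -PK.
have p0 : (0 <= fine (P K))%R by exact: fine_ge0.
have mZV : measurable_fun setT (fun w => (Z k w, V k.+1 w)).
  exact: measurable_fun_pair.
pose m1 := pushforward (mrestr P mK) (fun w => (Z k w, V k.+1 w)).
(* The restricted measure has total mass [P K], hence the scaling of the product. *)
pose m2 := mscale (NngNum p0) (distribution P (Z k) \x distribution P (V k.+1)).
transitivity (m1 H) => //.
transitivity (m2 H); last first.
  by rewrite /m2 /= /mscale/= fineK ?fin_num_measure// muleC.
apply: eq_measure_rectangle => //.
  rewrite /m1/= /pushforward /mrestr preimage_setT setTI.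
  by rewrite (le_lt_trans (probability_le1 _ _))// ltry.
move=> A B mA mB; rewrite /m2 /= /mscale/= fineK ?fin_num_measure//.
rewrite product_measure1E// muleC PK -prodE//.
Qed.

(** Independence of [Z k] and [V k.+1] alone would not propagate, because nothing would be known
    about [Z k.+1] and [V k.+2]. Quantifying over all finite families of later inputs makes the
    statement inductive. *)
Let joint_prod k : forall J, uniq J -> {in J, forall i, (k < i)%N} ->
  forall D E, measurable D -> (forall i, measurable (E i)) ->
    P (joint k J D E) = P (Z k @^-1` D) * \prod_(i <- J) P (V i @^-1` E i).
Proof.
elim: k => [|k IH] J uJ kJ D E mD mE.
  have J0 : 0%N \notin J by apply/negP => /kJ.
  (* [Z 0] is a function of [V 0], so its event becomes the event of index 0 in the family. *)
  have := V_indep (0%N :: J) (fun i => if i == 0%N then h0 @^-1` D else E i).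
  rewrite /= J0 uJ big_cons eqxx.
  have -> : V 0%N @^-1` (h0 @^-1` D) = Z 0%N @^-1` D.
    by apply/seteqP; split => w /=; rewrite Z_init.
  rewrite [X in _ * X](eq_big_seq (fun i => P (V i @^-1` E i))); last first.
    by move=> i iJ; case: eqP => // i0; move: J0; rewrite -i0 iJ.
  move=> <- //; last first.
    move=> i; case: ifP => // _; rewrite -[X in measurable X]setTI; exact: mh0.
  congr (P _); apply/seteqP; split => w /=.
    move=> [Dw Kw] i /=; rewrite inE; case: eqP => [->/=|/= _]; last exact: Kw.
    by rewrite -Z_init.
  move=> Kw; split.
    by have := Kw 0%N (mem_head _ _); rewrite /= -Z_init.
  move=> i iJ; have := Kw i; rewrite /= inE iJ orbT => /(_ erefl).
  by case: eqP => // ij; move: J0; rewrite -ij iJ.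
have kJ' : uniq (k.+1 :: J).
  by rewrite /= uJ andbT; apply/negP => /kJ; rewrite ltnn.
have kk J' : uniq J' -> {in J', forall i, (k.+1 < i)%N} ->
    P (joint k.+1 J' D E) =
    (distribution P (Z k) \x distribution P (V k.+1))%E (h @^-1` D) *
    \prod_(i <- J') P (V i @^-1` E i).
  move=> uJ' J'k; rewrite -joint_step//.
  - by congr (P _); apply/seteqP; split => w /=; rewrite /joint/= Z_rec.
  - by rewrite /= uJ' andbT; apply/negP => /J'k; rewrite ltnn.
  - move=> D' E' mD' mE'; apply: IH => //.
      by rewrite /= uJ' andbT; apply/negP => /J'k; rewrite ltnn.
    by move=> i; rewrite inE => /orP[/eqP->//|/J'k]; exact: ltn_trans.
  - by rewrite -[X in measurable X]setTI; exact: mh.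
(* The empty family identifies the remaining factor as the law of [Z k.+1]. *)
rewrite kk//; congr (_ * _).
by have := kk [::] isT; rewrite joint_nil big_nil mule1 => <-.
Qed.

Lemma distribution_recursion k H : measurable H ->
  P [set w | H (Z k w, V k.+1 w)] =
  (distribution P (Z k) \x distribution P (V k.+1))%E H.
Proof.
move=> mH; have := @joint_step k [::] isT _ H (fun=> setT) mH (fun=> measurableT).
rewrite big_nil mule1 => <-.
  by congr (P _); apply/seteqP; split => w /=; [split|case].
move=> D E mD mE; apply: joint_prod => //.
by move=> i; rewrite inE => /eqP ->.
Qed.

End recursion.

(** * The stationary equation *)

Section pos_part.
Context {R : realType}.

(** A maximum is below a bound exactly when both of its branches are. An upper bound on the next
    sojourn time thus becomes a lower bound on the current one, which is the origin of the minus
    sign in the equation. *)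
Lemma pos_part_leE (b s a x : R) :
  (pos_part (b - s) + a <= x) = (a <= x) && (a + b - x <= s).
Proof.
by rewrite /pos_part; case: (leP 0 (b - s)) => h;
  apply/idP/andP => [h'|[h1 h2]]; try split; lra.
Qed.

Lemma pos_part_ge0 (u : R) : 0 <= pos_part u.
Proof. by rewrite /pos_part le_max lexx. Qed.

Lemma ler_pos_part (u v : R) : u <= v -> pos_part u <= pos_part v.
Proof. by move=> uv; rewrite /pos_part ge_max !le_max lexx/= uv orbT. Qed.

Lemma continuous_pos_part : continuous (@pos_part R).
Proof. by move=> x; apply: continuous_max; [exact: cvg_cst|exact: cvg_id]. Qed.

Lemma measurable_ler_set {d} {T : measurableType d} (f g : T -> R) :
  measurable_fun setT f -> measurable_fun setT g ->
  measurable [set t | f t <= g t].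
Proof.
move=> mf mg; rewrite -[X in measurable X]setTI.
exact: (measurable_fun_ler mf mg measurableT (Y := [set true])).
Qed.

Lemma measurable_pos_part {d} {T : measurableType d} (f : T -> R) :
  measurable_fun setT f -> measurable_fun setT (fun t => pos_part (f t)).
Proof. by move=> mf; exact: (measurable_maxr (f := cst 0) (g := f)). Qed.

End pos_part.

Section distr_fun.
Context {d} {T : measurableType d} {R : realType} {P : probability T R}.
Variable X : {RV P >-> R}.

Lemma EFin_distr_fun r : (distr_fun X r)%:E = cdf X r.
Proof. by rewrite /distr_fun fineK// fin_num_measure. Qed.

Lemma distr_fun_ge0 r : 0 <= distr_fun X r.
Proof. exact: fine_ge0. Qed.

Lemma distr_fun_le1 r : distr_fun X r <= 1.
Proof. by rewrite -lee_fin EFin_distr_fun cdf_le1. Qed.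

Lemma distr_fun_nondecreasing : {homo distr_fun X : r s / r <= s}.
Proof. by move=> r s rs; rewrite -lee_fin !EFin_distr_fun cdf_nondecreasing. Qed.

Lemma measurable_distr_fun : measurable_fun setT (distr_fun X).
Proof. by apply: nondecreasing_measurable => //; exact: distr_fun_nondecreasing. Qed.

Lemma distr_funB r s : r <= s ->
  ((distr_fun X s - distr_fun X r)%:E = distribution P X `]r, s])%E.
Proof.
move=> rs; rewrite EFinB !EFin_distr_fun /cdf.
rewrite (@itv_bndbnd_setU _ _ -oo%O (BRight r) (BRight s))//.
rewrite measureU//; last first.
  apply/seteqP; split => // z [] /=; rewrite !in_itv/= => zr /andP[rz _].
  by move: (lt_le_trans rz zr); rewrite ltxx.
by rewrite addeAC subee ?add0e// fin_num_measure.
Qed.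

(** By absolute continuity of the integral, short intervals carry little mass. *)
Lemma has_density_continuous : has_density X -> continuous (distr_fun X).
Proof.
move=> [f [mf f0 fX]] r; apply/cvgrPdist_lt => e e0.
have intf : lebesgue_measure.-integrable setT (EFin \o f).
  apply/integrableP; split; first exact/measurable_EFinP.
  under eq_integral => x _ do rewrite gee0_abs ?lee_fin//.
  by rewrite -fX// probability_setT ltry.
have [c [c0 hc]] := integral_normr_continuous intf e0.
have key s t : s <= t -> t - s < c -> distr_fun X t - distr_fun X s < e.
  move=> st tsc; rewrite -lte_fin distr_funB// fX//.
  have stc : (lebesgue_measure (`]s, t]%classic : set R) < c%:E)%E.
    by rewrite lebesgue_measure_itv/= lte_fin; case: ifPn; rewrite ?lte_fin// -EFinB lte_fin.
  have := hc _ (measurable_itv `]s, t]) stc.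
  rewrite /Rintegral -lte_fin fineK.
    by under eq_integral => z _ do rewrite ger0_norm//.
  rewrite ge0_fin_numE; last by apply: integral_ge0 => z _; rewrite lee_fin.
  under eq_integral => z _ do rewrite ger0_norm//.
  by rewrite -fX// (le_lt_trans (probability_le1 _ _))// ltry.
near=> s.
have rsc : `|r - s| < c by near: s; exists c.
have [rs|/ltW sr] := leP r s.
  rewrite distrC ger0_norm ?subr_ge0 ?distr_fun_nondecreasing//.
  by apply: key => //; rewrite distrC ger0_norm ?subr_ge0 in rsc.
rewrite ger0_norm ?subr_ge0 ?distr_fun_nondecreasing//.
by apply: key => //; rewrite ger0_norm ?subr_ge0 in rsc.
Unshelve. all: by end_near. Qed.

End distr_fun.

(** * Passage to the limit in the recursion *)

Section stationary.
Local Open Scope ereal_scope.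
Context {d2} {T2 : measurableType d2} {R : realType} {P2 : probability T2 R}.
Context {d3} {T3 : measurableType d3} {P3 : probability T3 R}.
Variables (law : probability (R * R)%type R).
Variables (AB : nat -> {RV P2 >-> (R * R)%type}) (Sk : nat -> {RV P2 >-> R}).
Variable S : {RV P3 >-> R}.
Hypothesis AB_indep : mutually_independent AB.
Hypothesis AB_law : forall k E, measurable E -> distribution P2 (AB k) E = law E.
Hypothesis S_init : forall w, Sk 0%N w = ((AB 0%N w).2 + (AB 0%N w).1)%R.
Hypothesis S_rec : forall k w,
  Sk k.+1 w = (pos_part ((AB k.+1 w).2 - Sk k w) + (AB k.+1 w).1)%R.
Hypothesis S_lim : cvg_in_distribution Sk S.
Hypothesis S_cont : continuous (distr_fun S).

Variable x : R.
Let D : set (R * R) := [set p | p.1 <= x]%R.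
(** The ray is open because its complement, the section of [H1], is closed; [g k p] is therefore a
    left limit of the distribution function of [Sk k]. *)
Let g k (p : R * R) := distribution P2 (Sk k) `]-oo, (p.1 + p.2 - x)%R[.

Let mD : measurable D.
Proof. by apply: measurable_ler_set => //; exact: measurable_fst. Qed.

Let A k := distribution P2 (AB k).
Let H1 : set (R * (R * R)) := [set z | z.2.1 + z.2.2 - x <= z.1]%R.

Let mH1 : measurable H1.
Proof.
apply: measurable_ler_set; last exact: measurable_fst.
apply: measurable_funB => //; apply: measurable_funD.
  exact: (measurableT_comp measurable_fst measurable_snd).
exact: (measurableT_comp measurable_snd measurable_snd).
Qed.

Let gE k p : g k p = distribution P2 (Sk k) (ysection (~` H1) p).
Proof.
congr (distribution _ _ _); apply/seteqP; split => s; rewrite /ysection /= inE /H1/= in_itv/=.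
  by move=> h; apply/negP; rewrite -ltNge.
by move/negP; rewrite -ltNge.
Qed.

Let mg k : measurable_fun setT (g k).
Proof.
rewrite (_ : g k = distribution P2 (Sk k) \o ysection (~` H1)); last first.
  by apply/funext => p; exact: gE.
by apply: measurable_fun_ysection; exact: measurableC.
Qed.

(** For a fixed order [p] in [D], the sections of [H1] and of its complement have total mass 1. The
    sum form avoids a subtraction in the extended reals. *)
Let cdf_step k : cdf (Sk k.+1) x + \int[law]_(p in D) g k p = law D.
Proof.
have -> : cdf (Sk k.+1) x = \int[law]_(p in D) distribution P2 (Sk k) (ysection H1 p).
  transitivity (P2 [set w | (H1 `&` (setT `*` D)) (Sk k w, AB k.+1 w)]).
    congr (P2 _); apply/seteqP; split => w /=; rewrite in_itv/= S_rec pos_part_leE.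
      by move=> /andP[].
    by move=> [h [_ h']]; apply/andP.
  have mHD : measurable (H1 `&` (setT `*` D)).
    by apply: measurableI => //; exact: measurableX.
  rewrite (@distribution_recursion _ _ _ _ _ _ _ _ AB Sk (fun p => p.2 + p.1)%R
    (fun z => pos_part (z.2.2 - z.1) + z.2.1)%R)//.
  - transitivity (\int[distribution P2 (AB k.+1)]_p
        distribution P2 (Sk k) (ysection (H1 `&` (setT `*` D)) p)).
      rewrite -[RHS]/(\int[_]_p (distribution P2 (Sk k) \o ysection (H1 `&` (setT `*` D))) p).
      by rewrite -indic_fubini_tonelli_GE// -indic_fubini_tonelli// indic_fubini_tonelli_FE.
    rewrite [RHS]integral_mkcond.
    transitivity (\int[law]_p
        distribution P2 (Sk k) (ysection (H1 `&` (setT `*` D)) p)).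
      by apply: eq_measure_integral => E mE _; exact: AB_law.
    apply: eq_integral => p _; rewrite patchE.
    rewrite ysectionI; case: ifPn => pD.
      by rewrite in_ysectionX// setIT.
    by rewrite notin_ysectionX// setI0 measure0.
  - by apply: measurable_funD; [exact: measurable_snd|exact: measurable_fst].
  - apply: measurable_funD; last exact: (measurableT_comp measurable_fst measurable_snd).
    apply: measurable_pos_part; apply: measurable_funB.
      exact: (measurableT_comp measurable_snd measurable_snd).
    exact: measurable_fst.
rewrite -ge0_integralD//; last 2 first.
- by apply: measurable_funTS; exact: measurable_fun_ysection.
- exact: measurable_funTS.
transitivity (\int[law]_(p in D) 1); last by rewrite integral_cst// mul1e.
apply: eq_integral => p _; rewrite gE.
have -> : ysection (~` H1) p = ~` ysection H1 p.
  by apply/seteqP; split => s; rewrite /ysection/= !inE.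
rewrite -measureU//; last by rewrite setICr.
- by rewrite setUv; exact: probability_setT.
- exact: measurable_ysection.
- by apply: measurableC; exact: measurable_ysection.
Qed.

(* F_k(t - c) <= P(S_k < t) <= F_k(t), and both bounds come close to F_S(t). *)
Let cvg_g p : g k p @[k --> \oo] --> (distr_fun S (p.1 + p.2 - x))%:E.
Proof.
set t := (p.1 + p.2 - x)%R.
have gfin k : g k p \is a fin_num by rewrite /g fin_num_measure//; exact: measurable_itv.
have F_cvg r : distr_fun (Sk k) r @[k --> \oo] --> distr_fun S r.
  by apply: S_lim; exact: S_cont.
have gle k : (fine (g k p) <= distr_fun (Sk k) t)%R.
  rewrite fine_le ?fin_num_measure// le_measure ?inE//.
  by apply: subset_itvl; rewrite bnd_simp.
have gge k (c : R) : (0 < c -> distr_fun (Sk k) (t - c) <= fine (g k p))%R.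
  move=> c0; rewrite fine_le ?fin_num_measure// le_measure ?inE//.
  by apply: subset_itvl; rewrite bnd_simp ltrBlDr ltrDl.
suff : fine (g k p) @[k --> \oo] --> distr_fun S t.
  by move=> h; apply/fine_cvgP; split; [exact: nearW|exact: h].
apply/cvgrPdist_lt => e e0.
have e20 : (0 < e / 2)%R by exact: divr_gt0.
have /cvgrPdist_lt/(_ _ e20)/nbhs_ballP[c /= c0 hc] := S_cont t.
have c20 : (0 < c / 2)%R by exact: divr_gt0.
have /hc htc : ball t c (t - c / 2)%R.
  by rewrite /ball/= opprB addrCA subrr addr0 gtr0_norm//; lra.
near=> k.
have /= h1 : (`|distr_fun S t - distr_fun (Sk k) t| < e / 2)%R.
  by near: k; move/cvgrPdist_lt : (F_cvg t); exact.
have /= h2 : (`|distr_fun S (t - c / 2) - distr_fun (Sk k) (t - c / 2)| < e / 2)%R.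
  by near: k; move/cvgrPdist_lt : (F_cvg (t - c / 2)%R); exact.
have := gle k; have := gge k _ c20.
move: h1 h2 htc => /=; rewrite !ltr_norml => /andP[h11 h12] /andP[h21 h22] /andP[h31 h32] h4 h5.
by apply/andP; split; lra.
Unshelve. all: by end_near. Qed.

Lemma stationary_equation :
  (distr_fun S x)%:E + \int[law]_(p in D) (distr_fun S (p.1 + p.2 - x))%:E = law D.
Proof.
have mF : measurable_fun D (fun p : R * R => (distr_fun S (p.1 + p.2 - x))%:E).
  apply/measurable_EFinP; apply: measurable_funTS.
  apply: (measurableT_comp (measurable_distr_fun S)).
  apply: measurable_funB => //; apply: measurable_funD.
    exact: measurable_fst.
  exact: measurable_snd.
have g1 k p : `|g k p| <= cst 1 p.
  by rewrite gee0_abs// probability_le1.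
have [||||_ _ g_cvg] := @dominated_convergence _ _ _ law D mD (fun k p => g k p)
  (fun p => (distr_fun S (p.1 + p.2 - x))%:E) (cst 1) _ mF.
- by move=> k; exact: measurable_funTS.
- by apply/aeW => p _; exact: cvg_g.
- exact: finite_measure_integrable_cst.
- by apply/aeW => p k _; exact: g1.
have cvg_cdf : cdf (Sk k.+1) x @[k --> \oo] --> (distr_fun S x)%:E.
  apply/fine_cvgP; split; first by apply: nearW => k; rewrite fin_num_measure.
  by rewrite (cvg_shiftS (fun k => distr_fun (Sk k) x)); apply: S_lim; exact: S_cont.
have sum_cvg : cdf (Sk k.+1) x + \int[law]_(p in D) g k p @[k --> \oo] -->
    (distr_fun S x)%:E + \int[law]_(p in D) (distr_fun S (p.1 + p.2 - x))%:E.
  by apply: cvgeD => //; exact: fin_num_adde_defr.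
(* By [cdf_step] the converging sum is constantly [law D]. *)
apply/esym; move/cvg_lim : sum_cvg => <- //.
by under eq_fun do rewrite cdf_step; rewrite lim_cst.
Qed.

End stationary.

(** * The law of (A, B) *)

Section geometry.
Context {R : realType}.

Definition origin_dist (t : R) : R := Num.min t (1 - t).

(** This is [cw_dist] on [[0, 1)] with the floor resolved, a form that linear arithmetic can
    handle. *)
Definition cw_arc (t s : R) : R := if t <= s then s - t else s - t + 1.

Lemma cw_distE (t s : R) : 0 <= t < 1 -> 0 <= s < 1 -> cw_dist t s = cw_arc t s.
Proof.
move=> /andP[t0 t1] /andP[s0 s1]; rewrite /cw_dist /frac_part /cw_arc.
case: (leP t s) => ts.
  have -> : Num.floor (s - t) = 0 by apply: floor_def; apply/andP; split; lra.
  by rewrite subr0.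
have -> : Num.floor (s - t) = -1.
  by apply: floor_def; rewrite mulrNz mulr1z addNr mulr0z; apply/andP; split; lra.
by rewrite mulrNz mulr1z opprK.
Qed.

Lemma circle_dist0 (t : R) : 0 < t < 1 -> circle_dist 0 t = origin_dist t.
Proof.
move=> /andP[t0 t1]; rewrite /circle_dist !cw_distE ?lexx ?ltr01 ?ltW ?t1//.
rewrite /cw_arc (ltW t0) leNgt t0/= subr0 /origin_dist; congr Num.min; lra.
Qed.

(* Position of the nearest item first, position of another item second. *)
Definition sweep_cw (y : R) : set (R * R) :=
  [set p | origin_dist p.1 <= origin_dist p.2 /\ cw_arc p.1 p.2 <= y].

Definition sweep_ccw (y : R) : set (R * R) :=
  [set p | origin_dist p.1 <= origin_dist p.2 /\ cw_arc p.2 p.1 <= y].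

Context {n : nat}.
Variable x : 'I_n -> R.
Hypothesis x01 : forall i, 0 < x i < 1.
Hypothesis x_inj : injective (origin_dist \o x).

Lemma nearest_itemP : (0 < n)%N ->
  exists i, nearest_item x = Some i /\
    forall j, origin_dist (x i) <= origin_dist (x j).
Proof.
move=> n0; rewrite /nearest_item; case: pickP => [i /forallP h|h].
  by exists i; split => // j; have := h j; rewrite !circle_dist0.
pose i0 := Ordinal n0.
case: (@arg_minP _ _ _ i0 predT (fun i => origin_dist (x i)) isT) => i _ hi.
have := h i; move/forallP; case => j; rewrite !circle_dist0//; exact: hi.
Qed.

Lemma nearest_unique (i i' : 'I_n) :
  (forall j, j != i -> origin_dist (x i) <= origin_dist (x j)) ->
  (forall j, j != i' -> origin_dist (x i') <= origin_dist (x j)) -> i = i'.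
Proof.
move=> hi hi'; have [//|ii'] := eqVneq i i'.
by apply/x_inj/le_anti => /=; rewrite hi ?hi'// eq_sym.
Qed.

(** The sweep sets contain the condition that the first point is at most as far from the origin as
    the second. Any witness is therefore a nearest item, and [nearest_unique] identifies it with the
    index that [nearest_item] selects. *)
Lemma pick_preparationP (y : R) (E : set R) : (0 < n)%N -> 0 <= y ->
  (pick_time x <= y /\ E (preparation_time x)) <->
  exists i, E (origin_dist (x i)) /\
    ((forall j, j != i -> sweep_cw y (x i, x j)) \/
     (forall j, j != i -> sweep_ccw y (x i, x j))).
Proof.
move=> n0 y0; have [i [xi hi]] := nearest_itemP n0.
have x01' j : 0 <= x j < 1 by have /andP[h ->] := x01 j; rewrite ltW.
rewrite /pick_time /preparation_time xi circle_dist0// ge_min.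
rewrite (eq_bigr (fun j => cw_arc (x i) (x j))); last by move=> j _; exact: cw_distE.
rewrite [X in _ || (X <= y)](eq_bigr (fun j => cw_arc (x j) (x i))); last first.
  by move=> j _; exact: cw_distE.
split.
  move=> [h Ei]; exists i; split => //.
  case/orP : h => /bigmax_leP[_ h]; [left|right] => j ji; split; rewrite ?hi// h//.
move=> [i' [Ei' h]].
have ii' : i = i'.
  apply: nearest_unique => // j ji'; by case: h => /(_ j ji')[].
subst i'; split => //.
(* The assumption [0 <= y] takes care of the default value 0 of the maximum. *)
by apply/orP; case: h => h; [left|right]; apply/bigmax_leP; split => // j /h[].
Qed.

End geometry.

(** For a nearest item at position [u], the other items lie in [[u, 1 - u]]. A clockwise sweep
    within [y] cuts this interval at [u + y]. A counter-clockwise one cuts it at [u + 1 - y], having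
    first crossed an empty arc of length [2 * u]. The three lemmas measure the two cut intervals and
    their intersection. *)
Lemma arc_length1 (R : realType) (u y : R) : 0 <= y -> 0 <= 1 - 2 * u ->
  Num.max 0 (Num.min (1 - u) (u + y) - u) = Num.min y (1 - 2 * u).
Proof.
move=> y0 u1; case: (leP y (1 - 2 * u)) => h.
  rewrite [Num.min _ _]min_r ?max_r; lra.
rewrite [Num.min _ _]min_l ?max_r; lra.
Qed.
Lemma arc_length2 (R : realType) (u y : R) :
  1 - u - Num.max u (u + 1 - y) = Num.min (1 - 2 * u) (y - 2 * u).
Proof.
case: (leP 1 y) => h.
  rewrite max_l ?min_l; lra.
rewrite max_r ?min_r; lra.
Qed.
(** The cuts [u + 1 - y] and [u + y] alone bound an interval of length [2 * y - 1], whatever [u]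
    is. *)
Lemma arc_length3 (R : realType) (u y : R) : 0 <= u ->
  Num.min (1 - u) (u + y) - Num.max u (u + 1 - y) =
  Num.min (Num.min (1 - 2 * u) (y - 2 * u)) (2 * y - 1).
Proof.
move=> u0; rewrite -arc_length2; case: (leP (1 - u) (u + y)) => h.
  rewrite min_l//; have : u + 1 - y <= Num.max u (u + 1 - y) by rewrite le_max lexx orbT.
  lra.
case: (leP 1 y) => h1.
  rewrite [Num.max _ _]max_l ?min_r; lra.
rewrite [Num.max _ _]max_r ?min_r; lra.
Qed.

Lemma origin_dist_leE (R : realType) (u s : R) :
  (u <= origin_dist s) = (u <= s <= 1 - u).
Proof. by rewrite /origin_dist le_min lerBrDr -lerBrDl. Qed.

Lemma sweep_cw_itv (R : realType) (u y s : R) : s != u ->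
  (u <= s <= 1 - u /\ cw_arc u s <= y) <-> u <= s <= Num.min (1 - u) (u + y).
Proof.
rewrite le_min neq_lt /cw_arc => /orP su; split=> [[/andP[h1 h2]]|/and3P[h1 h2 h3]].
  by rewrite h1 => h3; apply/and3P; split; lra.
by rewrite h1; split; [apply/andP; split|]; lra.
Qed.

(** At [s = u] the arc has length 0 rather than a full turn, so the interval description can fail at
    this single point, which has measure 0. *)
Lemma sweep_ccw_itv (R : realType) (u y s : R) : s != u ->
  (u <= s <= 1 - u /\ cw_arc s u <= y) <-> Num.max u (u + 1 - y) <= s <= 1 - u.
Proof.
rewrite ge_max neq_lt /cw_arc => /orP su; split=> [[/andP[h1 h2]]|/andP[/andP[h1 h2] h3]].
  have -> : (s <= u) = false by apply/negP => ?; lra.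
  by move=> h3; apply/andP; split => //; apply/andP; split; lra.
have -> : (s <= u) = false by apply/negP => ?; lra.
by split; [apply/andP; split|]; lra.
Qed.

Lemma sweep_both_itv (R : realType) (u y s : R) : s != u ->
  (u <= s <= 1 - u /\ cw_arc u s <= y /\ cw_arc s u <= y) <->
  Num.max u (u + 1 - y) <= s <= Num.min (1 - u) (u + y).
Proof.
move=> su; split=> [[h1 [h2 h3]]|/andP[h1 h2]].
  have /andP[_ ->] := (sweep_cw_itv _ _ _ _ su).1 (conj h1 h2).
  by have /andP[-> _] := (sweep_ccw_itv _ _ _ _ su).1 (conj h1 h3).
have us : u <= s by move: h1; rewrite ge_max => /andP[].
have s1 : s <= 1 - u by move: h2; rewrite le_min => /andP[].
split; first by rewrite us.
have [_ ->] := (sweep_cw_itv _ u y s su).2 (introT andP (conj us h2)).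
by have [_ ->] := (sweep_ccw_itv _ u y s su).2 (introT andP (conj h1 s1)).
Qed.

(** Reflection in the origin exchanges the two directions; it reduces a nearest item beyond [1 / 2]
    to one at position [u]. *)
Lemma cw_arc_onem (R : realType) (t s : R) : cw_arc (1 - t) (1 - s) = cw_arc s t.
Proof. by rewrite /cw_arc lerD2l lerN2; case: ifP => _; lra. Qed.

(** * Sweep probabilities with the position of the nearest item frozen *)

Section section_measures.
Context {R : realType}.
Local Notation Q := (@unif01 R).

Lemma lebR_itv_point (A : set R) (t a b : R) : measurable A ->
  (forall s, s != t -> A s <-> a <= s <= b) ->
  lebR A = (Num.max 0 (b - a))%:E.
Proof.
rewrite /lebR.
move=> mA hA.
have null (B : set R) : measurable B ->
    lebesgue_measure B = lebesgue_measure (B `\ t).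
  move=> mB; rewrite -[in LHS](setDUK (A := [set t] `&` B) (B := B)); last by move=> z [].
  rewrite measureU//=; last 3 first.
  - exact: measurableI.
  - by apply: measurableD => //; exact: measurableI.
  - by rewrite setDE setIA setIAC setICr set0I.
  have -> : lebesgue_measure ([set t] `&` B) = 0%E.
    apply/eqP; rewrite eq_le measure_ge0 andbT -(lebesgue_measure_set1 t).
    by rewrite le_measure ?inE//; exact: measurableI.
  rewrite add0e; congr (lebesgue_measure _).
  by apply/seteqP; split => s /= [Bs h]; split => //; tauto.
rewrite null// (_ : A `\ t = `[a, b] `\ t); last first.
  apply/seteqP; split => s /= [h /eqP st]; split; try exact/eqP.
    by rewrite in_itv/=; apply/(hA _ st).
  by apply/(hA _ st); rewrite in_itv/= in h.
rewrite -null// lebesgue_measure_itv/= lte_fin.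
case: ltP => ab; first by rewrite max_r// ?EFinB// subr_ge0 ltW.
by rewrite max_l// subr_le0.
Qed.

Lemma measurable_origin_dist : measurable_fun setT (@origin_dist R).
Proof. by apply: measurable_minr => //; exact: measurable_funB. Qed.

Lemma measurable_cw_arc d (T : measurableType d) (f g : T -> R) :
  measurable_fun setT f -> measurable_fun setT g ->
  measurable_fun setT (fun z => cw_arc (f z) (g z)).
Proof.
move=> mf mg; rewrite /cw_arc; apply: measurable_fun_ifT.
- exact: measurable_fun_ler.
- exact: measurable_funB.
- by apply: measurable_funD => //; exact: measurable_funB.
Qed.

Lemma measurable_sweep_cw y : measurable (@sweep_cw R y).
Proof.
apply: measurableI; apply: measurable_ler_set => //.
- exact: (measurableT_comp measurable_origin_dist measurable_fst).
- exact: (measurableT_comp measurable_origin_dist measurable_snd).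
- by apply: measurable_cw_arc; [exact: measurable_fst|exact: measurable_snd].
Qed.

Lemma measurable_sweep_ccw y : measurable (@sweep_ccw R y).
Proof.
apply: measurableI; apply: measurable_ler_set => //.
- exact: (measurableT_comp measurable_origin_dist measurable_fst).
- exact: (measurableT_comp measurable_origin_dist measurable_snd).
- by apply: measurable_cw_arc; [exact: measurable_snd|exact: measurable_fst].
Qed.

(* The probability that [m] uniform points are all at distance at least [u]
   from the origin and can be swept within distance [y], in at least one of the
   two directions, from an item at distance [u]. *)
Definition sweep_kernel (m : nat) (u y : R) : R :=
  let Y := Num.min y (1 - 2 * u) in
  Y ^+ m + pos_part (Y - 2 * u) ^+ m - pos_part (2 * Y - 1) ^+ m.

Lemma sweep_kernel_ge0 (m : nat) (u y : R) : (0 <= u <= 1 / 2)%R -> (0 <= y)%R ->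
  (0 <= sweep_kernel m u y)%R.
Proof.
move=> /andP[u0 u1] y0; rewrite /sweep_kernel.
set Y := Num.min y _.
have Y0 : (0 <= Y)%R by rewrite /Y le_min y0/=; lra.
have Y1 : (Y <= 1)%R by rewrite /Y ge_min; apply/orP; right; lra.
rewrite addrAC addr_ge0//.
  rewrite subr_ge0 lerXn2r// ?nnegrE/pos_part ?le_max ?lexx// ge_max Y0/=.
  lra.
by rewrite exprn_ge0// /pos_part le_max lexx.
Qed.

Lemma measurable_sweep_kernel (m : nat) (y : R) :
  measurable_fun setT (fun u => sweep_kernel m u y).
Proof.
have m1 : measurable_fun setT (fun u : R => 1 - 2 * u)%R.
  by apply: measurable_funB => //; exact: measurable_funM.
have mY : measurable_fun setT (fun u : R => Num.min y (1 - 2 * u))%R.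
  exact: measurable_minr.
apply: measurable_funB; first apply: measurable_funD.
- exact: measurable_funX.
- apply: measurable_funX; apply: measurable_pos_part; apply: measurable_funB => //.
- apply: measurable_funX; apply: measurable_pos_part; apply: measurable_funB => //.
  exact: measurable_funM.
Qed.

Lemma sweep_sections (m : nat) (t y : R) : 0 < t < 1 -> 0 <= y ->
  fine (Q (xsection (sweep_cw y) t)) ^+ m + fine (Q (xsection (sweep_ccw y) t)) ^+ m
  - fine (Q (xsection (sweep_cw y `&` sweep_ccw y) t)) ^+ m
  = sweep_kernel m (origin_dist t) y.
Proof.
move=> /andP[t0 t1] y0.
have mcw := measurable_sweep_cw y; have mccw := measurable_sweep_ccw y.
have secE (G : set (R * R)) a b : measurable G ->
    (forall s, s != t -> (G (t, s) /\ 0 <= s <= 1) <-> a <= s <= b) ->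
    fine (Q (xsection G t)) = Num.max 0 (b - a).
  move=> mG hG; rewrite unif01E; last exact: measurable_xsection.
  rewrite (lebR_itv_point _ t a b)//.
    by apply: measurableI => //; exact: measurable_xsection.
  move=> s /hG <-; rewrite /xsection/= inE/= in_itv/=; split => -[]; auto.
pose u := origin_dist t.
pose a := Num.min y (1 - 2 * u).
pose b := Num.max 0 (Num.min (1 - 2 * u) (y - 2 * u)).
pose c := Num.max 0 (Num.min (Num.min (1 - 2 * u) (y - 2 * u)) (2 * y - 1)).
have u0 : 0 <= u by rewrite /u /origin_dist; case: (leP t (1 - t)) => ?; lra.
have u1 : 0 <= 1 - 2 * u by rewrite /u /origin_dist; case: (leP t (1 - t)) => ?; lra.
have key : a ^+ m + b ^+ m - c ^+ m = sweep_kernel m u y.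
  rewrite /sweep_kernel /pos_part -/a.
  have [yu|uy] := leP y (1 - 2 * u).
    have aE : a = y by rewrite /a min_l.
    have bE : b = Num.max 0 (a - 2 * u).
      by rewrite /b aE min_r//; lra.
    have cE : c = Num.max 0 (2 * a - 1).
      rewrite /c aE [Num.min _ (_ - 1)]min_r// le_min; apply/andP; split; lra.
    by rewrite -bE -cE.
  (* Beyond the length of the admissible arc a clockwise sweep always succeeds, so [c = b] and these
     terms cancel. They cancel in the kernel too, since [a - 2 * u = 2 * a - 1] when
     [a = 1 - 2 * u]. *)
  have aE : a = 1 - 2 * u by rewrite /a min_r// ltW.
  have -> : c = b.
    by rewrite /b /c [Num.min _ (_ - 1)]min_l// ge_min; apply/orP; right; lra.
  have -> : a - 2 * u = 2 * a - 1 by rewrite aE; lra.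
  by rewrite !addrK.
have mcI : measurable (sweep_cw y `&` sweep_ccw y) by exact: measurableI.
have u01 s : u <= s <= 1 - u -> 0 <= s <= 1 by move=> /andP[? ?]; apply/andP; split; lra.
(* Both halves of the circle are treated at once: for [t > 1 / 2] the section is described after
   reflection. *)
have sec (G : set (R * R)) al be : measurable G ->
    (forall s, s != u -> G (t, if t <= 1 / 2 then s else 1 - s) <-> al <= s <= be) ->
    u <= al -> be <= 1 - u -> fine (Q (xsection G t)) = Num.max 0 (be - al).
  move=> mG hG al0 be1; case: (leP t (1 / 2)) hG => th hG.
    have ut : t = u by rewrite /u /origin_dist min_l//; lra.
    apply: secE => // s; rewrite {1}ut => su; split=> [[/(hG _ su)]//|h].
    split; first exact/(hG _ su).
    by move: h => /andP[h1 h2]; apply/andP; split; lra.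
  have ut : t = 1 - u by rewrite /u /origin_dist min_r ?subKr//; lra.
  rewrite (secE _ (1 - be) (1 - al))//; first by congr Num.max; lra.
  move=> s st; have su : 1 - s != u by rewrite ut in st; apply: contra_neq st => <-; rewrite subKr.
  have := hG _ su; rewrite subKr => {}hG; split.
    by move=> [/hG/andP[h1 h2] _]; apply/andP; split; lra.
  move=> /andP[h1 h2]; split; first by apply/hG; apply/andP; split; lra.
  by apply/andP; split; lra.
rewrite -/u -key /a /b /c -(arc_length1 _ _ _ y0 u1) -(arc_length3 _ _ _ u0) -arc_length2.
have maxu : u <= Num.max u (u + 1 - y) by rewrite le_max lexx.
have minu : Num.min (1 - u) (u + y) <= 1 - u by rewrite ge_min lexx.
case: (leP t (1 / 2)) sec => th sec.
  have ut : t = u by rewrite /u /origin_dist min_l//; lra.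
  rewrite (sec _ _ _ mcw _ (lexx _) minu); last first.
    by move=> s su; rewrite /sweep_cw/= -/u origin_dist_leE ut; exact: sweep_cw_itv.
  rewrite (sec _ _ _ mccw _ maxu (lexx _)); last first.
    by move=> s su; rewrite /sweep_ccw/= -/u origin_dist_leE ut; exact: sweep_ccw_itv.
  rewrite (sec _ _ _ mcI _ maxu minu)// => s su.
  rewrite -sweep_both_itv// /sweep_cw /sweep_ccw /= -/u origin_dist_leE ut.
  by split=> [[[? ?] []]//|[? []]].
have ut : t = 1 - u by rewrite /u /origin_dist min_r ?subKr//; lra.
have odE s : origin_dist (1 - s) = origin_dist s.
  by rewrite /origin_dist subKr minC.
(* After reflection the clockwise section has the counter-clockwise interval, so the first two terms
   come out swapped. *)
rewrite (sec _ _ _ mcw _ maxu (lexx _)); last first.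
  move=> s su; rewrite /sweep_cw/= -/u odE origin_dist_leE ut cw_arc_onem.
  exact: sweep_ccw_itv.
rewrite (sec _ _ _ mccw _ (lexx _) minu); last first.
  move=> s su; rewrite /sweep_ccw/= -/u odE origin_dist_leE ut cw_arc_onem.
  exact: sweep_cw_itv.
rewrite (sec _ _ _ mcI _ maxu minu)//; last first.
  move=> s su; rewrite -sweep_both_itv// /sweep_cw /sweep_ccw /= -/u.
  rewrite odE origin_dist_leE ut !cw_arc_onem.
  by split=> [[[? ?] []]//|[? []]].
by rewrite [X in X - _]addrC.
Qed.

End section_measures.

Section independent_sections.
Local Open Scope ereal_scope.
Context {d d1} {T : measurableType d} {T1 : measurableType d1} {R : realType}.
Variables (P : probability T R) (Q : probability T1 R).
Variables (I : choiceType) (X : I -> {RV P >-> T1}).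
Hypothesis X_indep : mutually_independent X.
Hypothesis X_law : forall i E, measurable E -> P (X i @^-1` E) = Q E.

Lemma independent_sections (i : I) (J : seq I) (G : I -> set (T1 * T1)) :
  uniq (i :: J) -> (forall j, measurable (G j)) -> forall D, measurable D ->
  P [set w | D (X i w) /\ forall j, j \in J -> G j (X i w, X j w)] =
  \int[Q]_(t in D) (\prod_(j <- J) fine (Q (xsection (G j) t)))%:E.
Proof.
move=> /= /andP[iJ uJ] mG D mD.
have := @probability_sections _ _ _ _ _ _ _ P Q Q I (X i) X J G setT uJ measurableT mG.
rewrite probability_setT => /(_ _ _ mD); rewrite mule1 => <-.
  by congr (P _); apply/seteqP; split => w /= [].
move=> D' E mD' mE; rewrite mule1.
have := X_indep (i :: J) (fun j => if j == i then D' else E j).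
rewrite /= iJ uJ big_cons eqxx (X_law i)// => h.
rewrite (eq_big_seq (fun j => P (X j @^-1` (if j == i then D' else E j)))); last first.
  move=> j jJ; rewrite -(X_law j)//; case: eqP => // ji; by move: iJ; rewrite -ji jJ.
rewrite -h//; last by move=> j; case: ifP.
congr (P _); apply/seteqP; split => w /=.
  move=> [Dw Jw _] j /=; rewrite inE; case: eqP => [->//|/= _]; exact: Jw.
move=> h'; split => //.
  by have := h' i (mem_head _ _); rewrite eqxx.
move=> j jJ; have := h' j; rewrite /= inE jJ orbT => /(_ erefl).
by case: eqP => // ji; move: iJ; rewrite -ji jJ.
Qed.

End independent_sections.

(** * Joint law of one order in terms of the sweep kernel *)

Section order_law.
Local Open Scope ereal_scope.
Context {R : realType} {d} {T : measurableType d} {P : probability T R} {n : nat}.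
Variable X : 'I_n -> {RV P >-> R}.
Hypothesis X_indep : mutually_independent X.
Hypothesis X_unif : forall i, uniform_on_circle (X i).
Local Notation Q := (@unif01 R).

Let X_law i E : measurable E -> P (X i @^-1` E) = Q E.
Proof. exact: X_unif. Qed.

Let ae_01 i : {ae P, forall w, (0 < X i w < 1)%R}.
Proof.
exists (X i @^-1` (~` `]0%R, 1%R[)); split.
- by apply: measurable_funPTI; exact: measurableC.
- rewrite X_law; last exact: measurableC.
  rewrite probability_setC//= unif01E// setIidl; last exact: subset_itv_oo_cc.
  by rewrite /lebR lebesgue_measure_itv/= lte_fin ltr01 sube0 subee.
- by move=> w /= h; rewrite in_itv/=.
Qed.

Let ae_neq i j : i != j -> {ae P, forall w, origin_dist (X i w) != origin_dist (X j w)}.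
Proof.
move=> ij.
pose G : set (R * R) := [set p | origin_dist p.1 = origin_dist p.2].
have mG : measurable G.
  rewrite (_ : G = [set p | origin_dist p.1 <= origin_dist p.2]%R `&`
                   [set p | origin_dist p.2 <= origin_dist p.1]%R).
    have m1 := measurableT_comp (@measurable_origin_dist R) (@measurable_fst _ _ R R).
    have m2 := measurableT_comp (@measurable_origin_dist R) (@measurable_snd _ _ R R).
    by apply: measurableI; exact: measurable_ler_set.
  apply/seteqP; split => p /=; first by rewrite /G/= => ->; rewrite lexx.
  by move=> [h1 h2]; apply/le_anti; rewrite h1 h2.
exists [set w | origin_dist (X i w) = origin_dist (X j w)]; split.
- rewrite -[X in measurable X](_ : (fun w => (X i w, X j w)) @^-1` G = _)//.
  rewrite -[X in measurable X]setTI; apply: measurable_fun_pair => //.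
- have := @independent_sections _ _ _ _ _ P Q _ X X_indep X_law i [:: j]
    (fun=> G) _ (fun=> mG) setT measurableT.
  rewrite /= inE ij/= => /(_ erefl) h.
  transitivity (P [set w | setT (X i w) /\ (forall j0, j0 \in [:: j] -> G (X i w, X j0 w))]).
    congr (P _); apply/seteqP; split => w /=.
      by move=> h'; split => // k; rewrite inE => /eqP ->.
    by move=> [_]; apply; rewrite mem_head.
  rewrite h; apply: integral0_eq => t _.
  rewrite big_seq1; have -> : Q (xsection G t) = 0 => //.
  rewrite unif01E; last exact: measurable_xsection.
  (* For a fixed [t] only [t] and [1 - t] are at the same distance from the origin. *)
  apply: (@subset_measure0 _ _ _ _ _ [set t; (1 - t)%R]) => //.
  - by apply: measurableI => //; exact: measurable_xsection.
  - by apply: measurableU; exact: measurable_set1.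
  - move=> s [+ _]; rewrite /xsection/= inE /G/= /origin_dist.
    by case: (leP t (1 - t)%R) => ?; case: (leP s (1 - s)%R) => ? ?; [left|right|right|left]; lra.
  - by apply: countable_lebesgue_measure0; apply: finite_set_countable.
- by move=> w /= /negP; rewrite negbK => /eqP.
Qed.

Let ae_good : {ae P, forall w, (forall i, (0 < X i w < 1)%R) /\
  injective (fun i => origin_dist (X i w))}.
Proof.
have h1 : {ae P, forall w, forall i, (0 < X i w < 1)%R} by apply: filter_forall.
have h2 : {ae P, forall w, forall i j, i != j -> origin_dist (X i w) != origin_dist (X j w)}.
  apply: filter_forall => i; apply: filter_forall => j.
  have [->|ij] := eqVneq i j; first by apply: aeW.
  by apply: filterS (ae_neq _ _ ij) => w h _.
apply: filterS2 h1 h2 => w h1 h2; split => // i j /eqP ij.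
by apply/eqP; apply: contraTT ij; exact: h2.
Qed.

Let D (E : set R) : set R := `]0%R, 1%R[%classic `&` (@origin_dist R) @^-1` E.

Let mD E : measurable E -> measurable (D E).
Proof.
move=> mE; apply: measurableI => //; rewrite -[X in measurable X]setTI.
exact: measurable_origin_dist.
Qed.

Let V (E : set R) (G : set (R * R)) i :=
  [set w | D E (X i w) /\ forall j, j != i -> G (X i w, X j w)].

Let P_V E G i : measurable E -> measurable G ->
  P (V E G i) = \int[Q]_(t in D E) (fine (Q (xsection G t)) ^+ n.-1)%:E.
Proof.
move=> mE mG.
have := @independent_sections _ _ _ _ _ P Q _ X X_indep X_law i
  [seq j <- enum 'I_n | j != i] (fun=> G) _ (fun=> mG) _ (mD _ mE).
rewrite /= mem_filter eqxx/= filter_uniq ?enum_uniq// => /(_ erefl) h.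
transitivity (P [set w | D E (X i w) /\
  (forall j, j \in [seq j <- enum 'I_n | j != i] -> G (X i w, X j w))]).
  congr (P _); apply/seteqP; split => w /= [Dw h'].
    by split => // j; rewrite mem_filter => /andP[+ _]; exact: h'.
  by split => // j ji; apply: h'; rewrite mem_filter ji mem_enum.
rewrite h; apply: eq_integral => t _; congr EFin.
rewrite big_filter big_enum_cond/= (eq_bigl (mem (predC1 i)))//.
by rewrite prodr_const cardC1 card_ord.
Qed.

Let good := [set w | (forall i, (0 < X i w < 1)%R) /\
  injective (fun i => origin_dist (X i w))].

Let mV E G i : measurable E -> measurable G -> measurable (V E G i).
Proof.
move=> mE mG.
have mJ : measurable [set w | forall j, j \in [seq j <- enum 'I_n | j != i] -> G (X i w, X j w)].
  apply: (@measurable_forall_seq _ T _ _ (fun j => [set w | G (X i w, X j w)])) => j.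
  rewrite -[X in measurable X]setTI.
  by apply: (measurable_fun_pair (f := X i) (g := X j)).
have mXD : measurable (X i @^-1` D E) by apply: measurable_funPTI; exact: mD.
rewrite (_ : V E G i = X i @^-1` D E `&` [set w | forall j,
    j \in [seq j <- enum 'I_n | j != i] -> G (X i w, X j w)]).
  exact: measurableI.
apply/seteqP; split => w /= [Dw h]; split => // j.
  by rewrite mem_filter => /andP[+ _]; exact: h.
by move=> ji; apply: h; rewrite mem_filter ji mem_enum.
Qed.

Let P_pick E y i : measurable E -> (0 <= y)%R ->
  P (V E (sweep_cw y) i `|` V E (sweep_ccw y) i) =
  \int[Q]_(t in D E) (sweep_kernel n.-1 (origin_dist t) y)%:E.
Proof.
move=> mE y0.
have mcw := @measurable_sweep_cw R y; have mccw := @measurable_sweep_ccw R y.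
have mb : measurable (@sweep_cw R y `&` sweep_ccw y) by exact: measurableI.
have -> : P (V E (sweep_cw y) i `|` V E (sweep_ccw y) i) =
    P (V E (sweep_cw y) i) + P (V E (sweep_ccw y) i)
    - P (V E (sweep_cw y) i `&` V E (sweep_ccw y) i).
  apply: measureUfinr; [exact: mV|exact: mV|].
  by rewrite (le_lt_trans (probability_le1 _ _)) ?ltry//; exact: mV.
have -> : V E (sweep_cw y) i `&` V E (sweep_ccw y) i = V E (sweep_cw y `&` sweep_ccw y) i.
  apply/seteqP; split => w /=.
    by move=> [[Dw h1] [_ h2]]; split => // j ji; split; [exact: h1|exact: h2].
  by move=> [Dw h]; split; split => // j /h[].
rewrite !P_V//.
have mf G m : measurable G ->
    measurable_fun (D E) (fun t => (fine (Q (xsection G t)) ^+ m)%:E).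
  move=> mG; apply/measurable_EFinP/measurable_funTS; apply: measurable_funX.
  exact: measurable_fun_prob_xsection.
have fin_int G m : measurable G ->
    \int[Q]_(t in D E) (fine (Q (xsection G t)) ^+ m)%:E \is a fin_num.
  move=> mG; rewrite ge0_fin_numE; last first.
    by apply: integral_ge0 => t _; rewrite lee_fin exprn_ge0 ?fine_ge0.
  apply: (@le_lt_trans _ _ (\int[Q]_(t in D E) 1)).
    apply: ge0_le_integral => //.
    - exact: mD.
    - by move=> t _; rewrite lee_fin exprn_ge0 ?fine_ge0.
    - exact: mf.
    move=> t _; rewrite lee_fin exprn_ile1 ?fine_ge0// -lee_fin fineK ?probability_le1//.
      exact: measurable_xsection.
    by rewrite fin_num_measure//; exact: measurable_xsection.
  rewrite integral_cst ?mul1e; last exact: mD.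
  by rewrite (le_lt_trans (probability_le1 _ _)) ?ltry//; exact: mD.
have mk : measurable_fun (D E) (fun t => (sweep_kernel n.-1 (origin_dist t) y)%:E).
  apply/measurable_EFinP/measurable_funTS.
  exact: (measurableT_comp (measurable_sweep_kernel _ _) measurable_origin_dist).
have od01 t : D E t -> (0 < t < 1)%R /\ (0 <= origin_dist t <= 1 / 2)%R.
  move=> [/= /[!in_itv]/= /andP[t0 t1] _]; split; first by rewrite t0 t1.
  by rewrite /origin_dist; case: (leP t (1 - t)%R) => h; apply/andP; split; lra.
set q1 := fun t => (fine (Q (xsection (sweep_cw y) t)) ^+ n.-1)%:E.
set q2 := fun t => (fine (Q (xsection (sweep_ccw y) t)) ^+ n.-1)%:E.
set q3 := fun t => (fine (Q (xsection (sweep_cw y `&` sweep_ccw y) t)) ^+ n.-1)%:E.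
set k := fun t => (sweep_kernel n.-1 (origin_dist t) y)%:E.
have q_ge0 t (G : set (R * R)) : 0 <= (fine (Q (xsection G t)) ^+ n.-1)%:E.
  by rewrite lee_fin exprn_ge0 ?fine_ge0.
have mDE : measurable (D E) by exact: mD.
(* Inclusion-exclusion in additive form; the intersection term is finite by [fin_int] and is
   cancelled afterwards. *)
have e : \int[Q]_(t in D E) q1 t + \int[Q]_(t in D E) q2 t =
         \int[Q]_(t in D E) k t + \int[Q]_(t in D E) q3 t.
  rewrite -(ge0_integralD _ mDE (fun t _ => q_ge0 t _) (mf _ _ mcw)
    (fun t _ => q_ge0 t _) (mf _ _ mccw)).
  rewrite -(ge0_integralD _ mDE _ mk (fun t _ => q_ge0 t _) (mf _ _ mb)); last first.
    by move=> t /od01[t01 ot]; rewrite lee_fin sweep_kernel_ge0.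
  apply: eq_integral => t /[!inE] /od01[t01 ot].
  rewrite /q1 /q2 /q3 /k -!EFinD -sweep_sections//; congr EFin.
  by rewrite subrK.
rewrite e addeK//; exact: fin_int.
Qed.

(** Off the null set of ties the event is a disjoint union over the item that is nearest, and all
    [n] parts have the same probability. *)
Lemma order_law_sections (A B : {RV P >-> R}) (E : set R) (y : R) :
  (0 < n)%N ->
  (forall w, A w = pick_time (fun i => X i w)) ->
  (forall w, B w = preparation_time (fun i => X i w)) ->
  measurable E -> (0 <= y)%R ->
  P [set w | (A w <= y)%R /\ E (B w)] =
  n%:R%:E * \int[Q]_(t in D E) (sweep_kernel n.-1 (origin_dist t) y)%:E.
Proof.
move=> n0 AE BE mE y0.
have mcw := @measurable_sweep_cw R y; have mccw := @measurable_sweep_ccw R y.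
have [N [mN N0 hN]] := ae_good.
have gw w : (~` N) w -> good w.
  by move=> Nw; apply: contrapT => h; apply: Nw; exact: hN.
have PN H : measurable H -> P H = P (H `&` ~` N).
  move=> mH; have PHN : P (H `&` N) = 0.
    by apply: (@subset_measure0 _ _ _ _ _ N) => //; exact: measurableI.
  by rewrite [LHS](measureDI _ mH mN) setDE [X in _ + X]PHN adde0.
pose W i := V E (sweep_cw y) i `|` V E (sweep_ccw y) i.
have mW i : measurable (W i) by apply: measurableU; exact: mV.
have mF : measurable [set w | (A w <= y)%R /\ E (B w)].
  apply: measurableI; first exact: measurable_ler_set.
  exact: measurable_funPTI.
rewrite PN//.
have -> : [set w | (A w <= y)%R /\ E (B w)] `&` ~` N =
    \big[setU/set0]_(i < n) (W i `&` ~` N).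
  rewrite -bigcup_seq; apply/seteqP; split => w.
    move=> [[Aw Ew] Nw]; have [x01 x_inj] := gw _ Nw.
    have := (@pick_preparationP R n (fun i => X i w) x01 x_inj y E n0 y0).1.
    rewrite -AE -BE => /(_ (conj Aw Ew))[i [Ei h]].
    exists i; rewrite /= ?mem_index_enum//; split => //.
    have Di : D E (X i w) by split => //=; rewrite in_itv/=; exact: x01.
    by case: h => h; [left|right].
  move=> [i _ [Wi Nw]]; have [x01 x_inj] := gw _ Nw; split => //.
  rewrite /= AE BE; apply/(@pick_preparationP R n (fun i => X i w) x01 x_inj y E n0 y0).
  by exists i; case: Wi => -[[_ Ei] h]; split => //; [left|right].
rewrite measure_bigsetU_ord//; last 2 first.
- by move=> i; apply: measurableI => //; exact: measurableC.
- move=> i j _ _ [w [[Wi Nw] [Wj _]]]; have [x01 x_inj] := gw _ Nw.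
  apply: (@nearest_unique R n (fun i => X i w) x_inj).
    by move=> k ki; case: Wi => -[_ /(_ k ki)[]].
  by move=> k kj; case: Wj => -[_ /(_ k kj)[]].
rewrite (eq_bigr (fun=> \int[Q]_(t in D E) (sweep_kernel n.-1 (origin_dist t) y)%:E)); last first.
  by move=> i _; apply: etrans (P_pick _ _ i mE y0); exact: esym (PN _ (mW i)).
by rewrite sumr_const card_ord mule_natl.
Qed.

End order_law.

(** * The density of (A, B) *)

Section calculus.
Context {R : realType}.

Lemma is_derive_pos_partX (m : nat) (x : R) : (0 < m)%N ->
  is_derive x 1 (fun u => pos_part u ^+ m.+1) (m.+1%:R * pos_part x ^+ m).
Proof.
move=> m0; have [x0|x0|->] := ltgtP x 0.
- rewrite {2}/pos_part max_l ?ltW// expr0n gtn_eqF// mulr0.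
  apply: (near_eq_is_derive (f := cst 0)) => //.
  near=> z; rewrite /pos_part max_l ?expr0n//.
  by apply: ltW; near: z; exact: lt_nbhsl.
- rewrite {2}/pos_part max_r ?ltW//.
  apply: (@near_eq_is_derive R R R (fun u : R => u ^+ m.+1)).
    near=> z; rewrite /pos_part max_r//.
    by apply: ltW; near: z; exact: lt_nbhsr.
  apply: DeriveDef; first exact: exprn_derivable.
  by rewrite exp_derive /GRing.scale/= mulr1.
- rewrite /pos_part maxxx expr0n gtn_eqF// mulr0.
  (* At the kink the slope function is [pos_part z ^+ m], which is continuous and vanishes at 0
     because [0 < m]. *)
  apply/is_derive1_caratheodory; exists (fun z => pos_part z ^+ m); split.
  - move=> z; rewrite /pos_part maxxx expr0n/= !subr0.
    by case: (leP 0 z) => z0; rewrite ?expr0n ?gtn_eqF// ?mul0r// exprSr.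
  - have := @continuous_comp _ _ _ (@pos_part R) (fun z => z ^+ m) 0 (@continuous_pos_part R 0).
    by apply; exact: exprn_continuous.
  - by rewrite /pos_part maxxx expr0n gtn_eqF.
Unshelve. all: by end_near. Qed.

(** The formula of [sweep_kernel] before the truncation at [1 - 2 * u]. *)
Definition sweep_primitive (m : nat) (u a : R) : R :=
  a ^+ m + pos_part (a - 2 * u) ^+ m - pos_part (2 * a - 1) ^+ m.

(** Derivative of [sweep_primitive m.+1 u]; the inner 2 is the chain rule for [2 * a - 1]. *)
Definition sweep_density (m : nat) (u a : R) : R :=
  m.+1%:R * (a ^+ m + pos_part (a - 2 * u) ^+ m - 2 * pos_part (2 * a - 1) ^+ m).

Lemma is_derive_sweep_primitive (m : nat) (u a : R) : (0 < m)%N ->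
  is_derive a 1 (sweep_primitive m.+1 u) (sweep_density m u a).
Proof.
move=> m0.
have d1 : is_derive a 1 (fun a : R => a ^+ m.+1) (m.+1%:R * a ^+ m).
  apply: DeriveDef; first exact: exprn_derivable.
  by rewrite exp_derive /GRing.scale/= mulr1.
have d2 : is_derive a 1 (fun a : R => pos_part (a - 2 * u) ^+ m.+1)
    (m.+1%:R * pos_part (a - 2 * u) ^+ m).
  have h : is_derive a 1 (fun a : R => a - 2 * u) 1.
    by apply: is_derive_eq; rewrite subr0.
  have := @is_derive1_comp _ (fun u => pos_part u ^+ m.+1)
    (fun a : R => a - 2 * u) a _ _ (is_derive_pos_partX _ (a - 2 * u) m0) h.
  by rewrite mulr1.
have d3 : is_derive a 1 (fun a : R => pos_part (2 * a - 1) ^+ m.+1)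
    (m.+1%:R * pos_part (2 * a - 1) ^+ m * 2).
  have h : is_derive a 1 (fun a : R => 2 * a - 1) 2.
    by apply: is_derive_eq; rewrite subr0 /GRing.scale/= mulr1.
  exact: (@is_derive1_comp _ (fun u => pos_part u ^+ m.+1)
    (fun a : R => 2 * a - 1) a _ _ (is_derive_pos_partX _ (2 * a - 1) m0) h).
apply: is_derive_eq (is_deriveB (is_deriveD d1 d2) d3) _.
by rewrite /sweep_density; ring.
Qed.

Lemma continuous_sweep_density (m : nat) (u : R) : continuous (sweep_density m u).
Proof.
have cP (g : R -> R) : continuous g -> continuous (fun a => pos_part (g a) ^+ m).
  move=> cg a.
  have h := @continuous_comp _ _ _ g (@pos_part R) a (cg a)
    (@continuous_pos_part R (g a)).
  exact: (@continuous_comp _ _ _ (@pos_part R \o g) (fun z => z ^+ m) a h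
    (@exprn_continuous _ _ _)).
move=> a; rewrite /sweep_density.
apply: cvgM; first exact: cvg_cst.
apply: cvgB; first apply: cvgD.
- exact: exprn_continuous.
- apply: (cP (fun a => a - 2 * u)) => b; apply: cvgB; [exact: cvg_id|exact: cvg_cst].
- apply: cvgM; first exact: cvg_cst.
  apply: (cP (fun a => 2 * a - 1)) => b; apply: cvgB; last exact: cvg_cst.
  by apply: cvgM; [exact: cvg_cst|exact: cvg_id].
Qed.

Lemma measurable_sweep_density d (T : measurableType d) (m : nat) (f g : T -> R) :
  measurable_fun setT f -> measurable_fun setT g ->
  measurable_fun setT (fun z => sweep_density m (f z) (g z)).
Proof.
move=> mf mg; have mc (c : R) : measurable_fun setT (cst c : T -> R) by [].
have mX (h : T -> R) : measurable_fun setT h ->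
    measurable_fun setT (fun z => pos_part (h z) ^+ m).
  by move=> mh; apply: measurable_funX; exact: measurable_pos_part.
have m1 := mX _ (measurable_funB mg (measurable_funM (mc 2) mf)).
have m2 := mX _ (measurable_funB (measurable_funM (mc 2) mg) (mc 1)).
exact: (measurable_funM (mc m.+1%:R) (measurable_funB
  (measurable_funD (measurable_funX _ mg) m1) (measurable_funM (mc 2) m2))).
Qed.

(** On this range both [a] and [a - 2 * u] are at least [2 * a - 1], so the two positive powers
    cover the one counted twice. *)
Lemma sweep_density_ge0 (m : nat) (u a : R) :
  0 <= u -> 0 <= a <= 1 - 2 * u -> 0 <= sweep_density m u a.
Proof.
move=> u0 /andP[a0 au]; rewrite /sweep_density mulr_ge0//.
have le1 : pos_part (2 * a - 1) ^+ m <= a ^+ m.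
  by apply: lerXn2r; rewrite ?nnegrE ?pos_part_ge0// /pos_part ge_max a0/=; lra.
have le2 : pos_part (2 * a - 1) ^+ m <= pos_part (a - 2 * u) ^+ m.
  by apply: lerXn2r; rewrite ?nnegrE ?pos_part_ge0// ler_pos_part//; lra.
lra.
Qed.

Lemma integral_sweep_density (m : nat) (u y : R) : (0 < m)%N ->
  0 <= u <= 1 / 2 -> 0 <= y ->
  (\int[lebR]_(a in `[0%R, (Num.min y (1 - 2 * u))%R]) (sweep_density m u a)%:E =
   (sweep_kernel m.+1 u y)%:E)%E.
Proof.
move=> m0 /andP[u0 u1] y0; set Y := Num.min y _.
have YE : sweep_kernel m.+1 u y = sweep_primitive m.+1 u Y by [].
have F0 : sweep_primitive m.+1 u 0 = 0.
  rewrite /sweep_primitive /pos_part !max_l ?expr0n/= ?subrr ?addr0 ?subr0//; lra.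
have Yge0 : 0 <= Y by rewrite /Y le_min y0/=; lra.
have Yle : Y <= 1 - 2 * u by rewrite /Y ge_min lexx orbT.
rewrite ge0_integral_lebR//; last 2 first.
- by apply/measurable_EFinP; apply: measurable_funTS; exact: measurable_sweep_density.
- move=> a /=; rewrite in_itv/= => /andP[a0 aY].
  by rewrite lee_fin sweep_density_ge0// a0 (le_trans aY).
(* The fundamental theorem of calculus is applied on a proper interval only, so [Y = 0] is treated
   apart. *)
move: Yge0; rewrite le_eqVlt => /predU1P[Y0|Y0].
  by rewrite -Y0 set_itv1 integral_set1 YE -Y0 F0.
have dF a := is_derive_sweep_primitive m u a m0.
have dF1 a : derivable (sweep_primitive m.+1 u) a 1 by have [] := dF a.
rewrite (@continuous_FTC2 _ _ (sweep_primitive m.+1 u))//.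
- by rewrite F0 sube0 YE.
- apply: continuous_subspaceT; exact: continuous_sweep_density.
- have cF a : {for a, continuous (sweep_primitive m.+1 u)}.
    apply/differentiable_continuous/derivable1_diffP; exact: dF1.
  split.
  + by move=> a _; exact: dF1.
  + by apply: cvg_at_right_filter; exact: cF.
  + by apply: cvg_at_left_filter; exact: cF.
- by move=> a _; rewrite derive1E; have [_ ->] := dF a.
Qed.

End calculus.

Section rays.
Local Open Scope ereal_scope.
Context {R : realType}.

Lemma eq_measure_ray (m1 m2 : {measure set R -> \bar R}) :
  m1 setT < +oo ->
  (forall y, m1 `]-oo, y]%classic = m2 `]-oo, y]%classic) ->
  forall A, measurable A -> m1 A = m2 A.
Proof.
move=> m1oo m12 A mA.
have fin1 (U : set R) : measurable U -> m1 U < +oo.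
  by move=> mU; apply: le_lt_trans m1oo; rewrite le_measure ?inE.
have m12oc (a b : R) : (a < b)%R -> m1 `]a, b]%classic = m2 `]a, b]%classic.
  move=> ab; have := m12 b.
  rewrite (@itv_bndbnd_setU _ _ -oo%O (BRight a) (BRight b)) ?bnd_simp ?ltW//.
  have dj : `]-oo, a]%classic `&` `]a, b]%classic = set0 :> set R.
    apply/seteqP; split => // z [] /=; rewrite !in_itv/= => za /andP[az _].
    by move: (lt_le_trans az za); rewrite ltxx.
  have U1 : m1 (`]-oo, a]%classic `|` `]a, b]%classic) = m1 `]-oo, a]%classic + m1 `]a, b]%classic.
    by rewrite measureU.
  have U2 : m2 (`]-oo, a]%classic `|` `]a, b]%classic) = m2 `]-oo, a]%classic + m2 `]a, b]%classic.
    by rewrite measureU.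
  rewrite U1 U2 m12 => h.
  have fin : m2 `]-oo, a]%classic \is a fin_num.
    by rewrite ge0_fin_numE// -m12 fin1.
  have := congr1 (fun z => z - m2 `]-oo, a]%classic) h.
  by rewrite /= ![m2 `]-oo, a]%classic + _]addeC !addeK.
apply: (measure_unique (@ocitv R) (fun k => `](- k%:R)%R, k%:R]%classic)) => //.
- exact: ocitvI.
- by move=> k; exists ((- k%:R)%R, k%:R).
- apply/seteqP; split => // z _; exists (Num.truncn `|z|).+1 => //=.
  rewrite in_itv/=; have := truncnS_gt `|z|; rewrite ltr_norml => /andP[-> z2].
  exact: ltW.
- by move=> _ /ocitvP[->|[[a b] /= ab ->]]; [rewrite !measure0|exact: m12oc].
- by move=> k; exact: fin1.
Qed.

(** This matches the form in which the law of [(A, B)] is known: [A] below a level, [B] in an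
    arbitrary set. Fixing the second factor reduces the claim to measures on the line. *)
Lemma eq_measure_ray_rectangle d (T : measurableType d)
    (m1 m2 : {measure set (R * T) -> \bar R}) :
  m1 setT < +oo ->
  (forall y E, measurable E -> m1 (`]-oo, y]%classic `*` E) = m2 (`]-oo, y]%classic `*` E)) ->
  forall X, measurable X -> m1 X = m2 X.
Proof.
move=> m1oo m12; apply: eq_measure_rectangle => // A E mA mE.
have mE' : measurable ([set: R] `*` E) by exact: measurableX.
pose r1 := pushforward (mrestr m1 mE') (fst : R * T -> R).
pose r2 := pushforward (mrestr m2 mE') (fst : R * T -> R).
have setE (U : set R) : (fst : R * T -> R) @^-1` U `&` ([set: R] `*` E) = U `*` E.
  by apply/seteqP; split => z [Uz Ez]; split => //; case: Ez.
have mfst : measurable_fun setT (fst : R * T -> R) by exact: measurable_fst.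
have : r1 A = r2 A.
  apply: eq_measure_ray => //.
    rewrite /r1 /= /pushforward /mrestr setE.
    by apply: le_lt_trans m1oo; rewrite le_measure ?inE//; exact: measurableX.
  by move=> y; rewrite /r1 /r2 /= /pushforward /mrestr !setE; exact: m12.
by rewrite /r1 /r2 /= /pushforward /mrestr !setE.
Qed.

End rays.

Section order_density.
Local Open Scope ereal_scope.
Context {R : realType}.

(* [m] stands for n - 2, and [p] for (a, b). *)
Definition order_density (m : nat) (p : R * R) : R :=
  if [&& 0 <= p.1, 0 <= p.2 & p.1 <= 1 - 2 * p.2]%R
  then (2 * m.+2%:R * sweep_density m p.2 p.1)%R else 0%R.

Lemma order_density_ge0 m p : (0 <= order_density m p)%R.
Proof.
rewrite /order_density; case: ifPn => // /and3P[p1 p2 p12].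
by rewrite mulr_ge0// sweep_density_ge0// p1.
Qed.

Lemma measurable_order_density m : measurable_fun setT (order_density m).
Proof.
apply: measurable_fun_ifT.
- apply: measurable_and; first exact: measurable_fun_ler.
  apply: measurable_and; first exact: measurable_fun_ler.
  apply: measurable_fun_ler; first exact: measurable_fst.
  by apply: measurable_funB => //; apply: measurable_funM => //; exact: measurable_snd.
- apply: measurable_funM => //; apply: measurable_sweep_density.
    exact: measurable_snd.
  exact: measurable_fst.
- by [].
Qed.

Definition order_law (m : nat) :=
  density_measure (lebR \x lebR)%E (order_density m)
    (measurable_order_density m) (order_density_ge0 m).

(** With [a] as the inner variable, the support of the density cuts [a <= y] down to the interval
    from 0 to [Num.min y (1 - 2 * t)], which is the truncation in [sweep_kernel]. *)
Lemma order_law_ray (m : nat) (y : R) (E : set R) : (0 < m)%N -> measurable E ->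
  order_law m (`]-oo, y]%classic `*` E) =
  if (0 <= y)%R then
    \int[lebR]_(t in `[0%R, (1 / 2)%R] `&` E) (2 * m.+2%:R * sweep_kernel m.+1 t y)%:E
  else 0.
Proof.
move=> m0 mE.
have mS : measurable (`]-oo, y]%classic `*` E) by exact: measurableX.
pose f (z : R * R) := ((EFin \o order_density m) \_ (`]-oo, y]%classic `*` E)) z.
have f0 z : 0 <= f z.
  by rewrite /f patchE; case: ifPn => // _; rewrite lee_fin order_density_ge0.
have mf : measurable_fun setT f.
  have md : measurable_fun setT (EFin \o order_density m).
    by apply/measurable_EFinP; exact: measurable_order_density.
  exact: (measurable_restrictT (EFin \o order_density m) mS).1 (measurable_funTS md).
rewrite /order_law /density_measure integral_mkcond.
rewrite (fubini_tonelli2 f)//.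
case: ifPn => y0; last first.
  apply: integral0_eq => t _; apply: integral0_eq => a _.
  rewrite /f patchE; case: ifPn => //; rewrite inE => -[/= + _].
  rewrite in_itv/= /order_density => ay.
  rewrite ifF//; apply/negP => /and3P[a0 _ _].
  by move: y0; rewrite (le_trans a0 ay).
rewrite [RHS]integral_mkcond; apply: eq_integral => t _.
rewrite /fubini_G patchE; case: ifPn => tE; last first.
  apply: integral0_eq => a _.
  rewrite /f patchE; case: ifPn => //; rewrite inE => -[/= _ Et].
  rewrite /order_density ifF//; apply/negP => /and3P/= [a0 t0 at1].
  move/negP: tE; apply; rewrite inE; split => //=.
  by rewrite in_itv/=; apply/andP; split; lra.
move: tE; rewrite inE => -[/= /[!in_itv]/= /andP[t0 t1] Et].
transitivity (\int[lebR]_(a in `[0%R, (Num.min y (1 - 2 * t))%R])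
    ((2 * m.+2%:R)%:E * (sweep_density m t a)%:E)).
  rewrite [RHS]integral_mkcond; apply: eq_integral => a _.
  rewrite /f !patchE.
  have -> : ((a, t) \in (`]-oo, y]%classic `*` E)) = (a <= y)%R.
    apply/idP/idP; rewrite inE; first by move=> [/= + _]; rewrite in_itv.
    by move=> ay; split => //=; rewrite in_itv.
  rewrite mem_setE in_itv/= le_min /order_density/= t0/=.
  by case: (leP a y) => ay; case: (leP 0%R a) => a0; case: leP => at1 //=; rewrite EFinM.
rewrite ge0_integralZl//.
- by rewrite integral_sweep_density ?t0//.
- apply/measurable_EFinP; apply: measurable_funTS.
  exact: measurable_sweep_density.
- move=> a /=; rewrite in_itv/= le_min => /and3P[a0 ay at1].
  by rewrite lee_fin sweep_density_ge0// a0.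
Qed.

(** [origin_dist] folds the unit interval two to one onto [[0, 1 / 2]], whence the factor 2. *)
Lemma ge0_integral_origin_dist (E : set R) (h : R -> R) :
  measurable E -> measurable_fun setT h ->
  (forall t, 0 <= t <= 1 / 2 -> 0 <= h t)%R ->
  \int[unif01]_(t in `]0%R, 1%R[%classic `&` (@origin_dist R) @^-1` E) (h (origin_dist t))%:E =
  \int[lebR]_(t in `[0%R, (1 / 2)%R] `&` E) (2 * h t)%:E.
Proof.
move=> mE mh h0.
set DE := _ `&` _.
have mod := @measurable_origin_dist R.
have mDE : measurable DE.
  by apply: measurableI => //; rewrite -[X in measurable X]setTI; exact: mod.
have mH : measurable (`[0%R, (1 / 2)%R] `&` E) by exact: measurableI.
pose g := ((EFin \o h) \_ (`[0%R, (1 / 2)%R] `&` E)).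
have mEh : measurable_fun setT (EFin \o h) by exact/measurable_EFinP.
have mg : measurable_fun setT g.
  exact: (measurable_restrictT (EFin \o h) mH).1 (measurable_funTS mEh).
have g0 t : 0 <= g t.
  rewrite /g patchE; case: ifPn => //; rewrite inE => -[/= + _].
  by rewrite in_itv/= lee_fin; exact: h0.
have mg' : measurable_fun setT (fun t : R => g (1 - t)%R).
  by apply: measurableT_comp => //; exact: measurable_funB.
pose F := (((EFin \o h) \o (@origin_dist R)) \_ DE).
have mF : measurable_fun setT F.
  apply: (measurable_restrictT ((EFin \o h) \o (@origin_dist R)) mDE).1.
  by apply: measurable_funTS; exact: measurableT_comp.
have od01 t : (0 < t < 1)%R -> (0 <= origin_dist t <= 1 / 2)%R.
  move=> /andP[t0 t1].
  by rewrite /origin_dist; case: (leP t (1 - t)%R) => k; apply/andP; split; lra.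
have F0 t : 0 <= F t.
  rewrite /F patchE; case: ifPn => //; rewrite inE => -[/= + _].
  by rewrite in_itv/= lee_fin => /od01/h0.
rewrite integral_mkcond ge0_integral_unif01//.
transitivity (\int[lebR]_t (g t + g (1 - t)%R)); last first.
  rewrite ge0_integralD// lebR_onem// -ge0_integralD// [RHS]integral_mkcond.
  apply: eq_integral => t _; rewrite /g !patchE; case: ifPn => _.
    by rewrite /= -EFinD; congr EFin; lra.
  by rewrite adde0.
rewrite integral_mkcond; apply: ge0_ae_eq_integral => //.
- exact: (measurable_restrictT F (measurable_itv `[0%R, 1%R])).1 (measurable_funTS mF).
- exact: emeasurable_funD.
- by move=> t _; rewrite patchE; case: ifPn.
- by move=> t _; rewrite adde_ge0.
(* The two integrands can differ only at the endpoints and at the fold, where both reflected copies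
   count the same point. *)
- exists (0%R |` [set 1%R; (1 / 2)%R]); split.
  + by apply: measurableU => //; apply: measurableU.
  + apply: countable_lebesgue_measure0; apply: finite_set_countable.
    by rewrite finite_setU; split.
  + move=> t /= ht; apply: contrapT => /not_orP[t0 /not_orP[t1 th]].
    apply: ht => _; rewrite /F /g !patchE.
    have inDE : (t \in DE) = (0 < t < 1)%R && (origin_dist t \in E).
      apply/idP/andP => [/set_mem[/= + Et]|[t01 /set_mem Et]].
        by rewrite in_itv/= => ->; split => //; exact: mem_set.
      by apply/mem_set; split => //=; rewrite in_itv.
    have inH (s : R) : (s \in `[0%R, (1 / 2)%R] `&` E) = (0 <= s <= 1 / 2)%R && (s \in E).
      apply/idP/andP => [/set_mem[/= + Et]|[t01 /set_mem Et]].
        by rewrite in_itv/= => ->; split => //; exact: mem_set.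
      by apply/mem_set; split => //=; rewrite in_itv.
    rewrite inDE !inH mem_setE in_itv/= /origin_dist.
    have t0' : t != 0%R by apply/eqP.
    have t1' : t != 1%R by apply/eqP.
    have /orP[tlt|tgt] : ((t < 1 / 2) || (1 / 2 < t))%R by rewrite -neq_lt; apply/eqP.
      have -> : (0 <= 1 - t <= 1 / 2)%R = false by apply/negP => /andP[? ?]; lra.
      rewrite min_l; last lra.
      have -> : (0 <= t <= 1)%R = (0 < t)%R.
        by rewrite lt_neqAle eq_sym t0'/=; case: (leP 0%R t) => //= ?; lra.
      have -> : (0 < t < 1)%R = (0 < t)%R by case: (ltP 0%R t) => //= ?; lra.
      have -> : (0 <= t <= 1 / 2)%R = (0 < t)%R.
        by rewrite lt_neqAle eq_sym t0'/=; case: (leP 0%R t) => //= ?; lra.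
      by rewrite adde0; case: (0 < t)%R.
    have -> : (0 <= t <= 1 / 2)%R = false by apply/negP => /andP[? ?]; lra.
    rewrite min_r; last lra.
    have -> : (0 <= t <= 1)%R = (t < 1)%R.
      by rewrite lt_neqAle t1'/=; case: (leP t 1%R) => ?; rewrite ?andbT ?andbF//; lra.
    have -> : (0 < t < 1)%R = (t < 1)%R.
      by case: (ltP t 1%R) => ?; rewrite ?andbT ?andbF//; lra.
    have -> : (0 <= 1 - t <= 1 / 2)%R = (t < 1)%R.
      by rewrite lt_neqAle t1'/=; apply/andP/idP => [[? ?]|?]; [|split]; lra.
    by rewrite add0e; case: (t < 1)%R.
Qed.

End order_density.

(** * Identification of the law of an order with its density *)

Section order_distribution.
Local Open Scope ereal_scope.
Context {R : realType}.

Lemma pick_time_ge0 n (x : 'I_n -> R) : (0 <= pick_time x)%R.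
Proof.
by rewrite /pick_time; case: nearest_item => // i; rewrite le_min !bigmax_ge_id.
Qed.

Context {d} {T : measurableType d} {P : probability T R} {m : nat}.
Variable X : 'I_m.+2 -> {RV P >-> R}.
Hypothesis m0 : (0 < m)%N.
Hypothesis X_indep : mutually_independent X.
Hypothesis X_unif : forall i, uniform_on_circle (X i).
Variables A B : {RV P >-> R}.
Hypothesis AE : forall w, A w = pick_time (fun i => X i w).
Hypothesis BE : forall w, B w = preparation_time (fun i => X i w).

Lemma order_distribution (H : set (R * R)) : measurable H ->
  P [set w | H (A w, B w)] = order_law m H.
Proof.
have mAB : measurable_fun setT (fun w => (A w, B w)) by exact: measurable_fun_pair.
pose law := pushforward P (fun w => (A w, B w)).
move=> mH; transitivity (law H) => //.
apply: eq_measure_ray_rectangle => //.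
  by rewrite /law /= /pushforward preimage_setT probability_setT ltry.
move=> y E mE; rewrite [RHS]order_law_ray//.
transitivity (P [set w | (A w <= y)%R /\ E (B w)]).
  by congr (P _).
case: ifPn => y0; last first.
  rewrite (_ : [set w | _] = set0) ?measure0//; apply/seteqP; split => // w /= [Aw _].
  by move/negP: y0; apply; apply: le_trans Aw; rewrite AE pick_time_ge0.
rewrite (@order_law_sections _ _ _ _ _ X)//.
have mk := @measurable_sweep_kernel R m.+1 y.
rewrite (ge0_integral_origin_dist _ _ mE mk); last first.
  by move=> t t01; exact: sweep_kernel_ge0.
rewrite -ge0_integralZl//.
- by apply: eq_integral => t _; rewrite -EFinM; congr EFin; ring.
- exact: measurableI.
- apply/measurable_EFinP; apply: measurable_funTS.
  exact: (measurable_funM (f := cst 2%R) (g := fun u => sweep_kernel m.+1 u y)).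
- move=> t [/= + _]; rewrite in_itv/= => t01.
  by rewrite lee_fin mulr_ge0// sweep_kernel_ge0.
Qed.

End order_distribution.

(** * The double integrals *)

Section iterated.
Context {R : realType}.
Variables (G : R * R -> R) (M : R).
Hypothesis mG : measurable_fun setT G.
Hypothesis G0 : forall p, 0 <= G p.
Hypothesis GM : forall a z, G (a, z) <= if (0 <= a <= 1) && (0 <= z <= 1) then M else 0.

Let mGa a : measurable_fun setT (fun z => (G (a, z))%:E).
Proof. by apply/measurable_EFinP; exact: measurable_fun_pair2. Qed.

Let mGG : measurable_fun setT (fun a => \int[lebR]_z (G (a, z))%:E)%E.
Proof.
apply: (@measurable_fun_fubini_tonelli_F _ _ _ _ _ (@lebR R) (EFin \o G)).
- exact/measurable_EFinP.
- by move=> p; rewrite lee_fin.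
Qed.

Let M0 : 0 <= M.
Proof. by have := GM 0 0; rewrite !lexx !ler01/=; exact: le_trans (G0 _). Qed.

Lemma le_inner_integral a :
  (\int[lebR]_z (G (a, z))%:E <= if (0 <= a <= 1)%R then M%:E else 0)%E.
Proof.
apply: (@le_trans _ _ (\int[lebR]_(z in `[0%R, 1%R])
    (if (0 <= a <= 1)%R then M%:E else 0))%E).
  rewrite [leRHS]integral_mkcond; apply: ge0_le_integral => //.
  - by move=> z _; rewrite lee_fin.
  - apply: (measurable_restrictT _ (measurable_itv _)).1.
    exact: measurable_cst.
  - move=> z _; have := GM a z; rewrite patchE mem_setE in_itv/=.
    by case: (0 <= a <= 1); case: (0 <= z <= 1); rewrite /= ?lee_fin.
rewrite integral_cst//= /lebR lebesgue_measure_itv/= lte_fin ltr01 sube0 mule1.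
by [].
Qed.

Lemma iterated_integral_fin_num :
  (\int[lebR]_a \int[lebR]_z (G (a, z))%:E)%E \is a fin_num.
Proof.
rewrite ge0_fin_numE; last first.
  by apply: integral_ge0 => a _; apply: integral_ge0 => z _; rewrite lee_fin.
apply: (@le_lt_trans _ _ (\int[lebR]_(a in `[0%R, 1%R]) M%:E)%E).
  rewrite [leRHS]integral_mkcond; apply: ge0_le_integral => //.
  - by move=> a _; apply: integral_ge0 => z _; rewrite lee_fin.
  - apply: (measurable_restrictT _ (measurable_itv _)).1.
    exact: measurable_cst.
  - by move=> a _; rewrite patchE mem_setE in_itv/=; exact: le_inner_integral.
by rewrite integral_cst//= /lebR lebesgue_measure_itv/= lte_fin ltr01 sube0 mule1 ltry.
Qed.

(** A real iterated integral applies [fine] at both levels. The inner one loses nothing, because the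
    bound on the unit square makes every inner integral finite. *)
Lemma iterated_Rintegral (lo hi : R) (up : R -> R) (h : R -> R -> R) :
  (forall a z, G (a, z) =
     if (lo <= a <= hi) && (0 <= z <= up a) then h a z else 0) ->
  \int[lebesgue_measure]_(a in `[lo, hi])
     \int[lebesgue_measure]_(z in `[0, up a]) h a z =
  fine (\int[lebR]_a \int[lebR]_z (G (a, z))%:E)%E.
Proof.
move=> GE.
have inner a : a \in `[lo, hi]%classic ->
    ((\int[lebesgue_measure]_(z in `[0, up a]) h a z)%:E =
     \int[lebR]_z (G (a, z))%:E)%E.
  rewrite mem_setE in_itv/= => alh.
  have e : (\int[lebesgue_measure]_(z in `[0%R, up a]) (h a z)%:E =
            \int[lebR]_z (G (a, z))%:E)%E.
    rewrite ge0_integral_lebR//; last by move=> z _; rewrite lee_fin.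
    rewrite integral_mkcond; apply: eq_integral => z _.
    by rewrite patchE mem_setE in_itv/= GE alh/=; case: ifP.
  rewrite /Rintegral e fineK// ge0_fin_numE; last first.
    by apply: integral_ge0 => z _; rewrite lee_fin.
  by apply: le_lt_trans (le_inner_integral a) _; case: ifP; rewrite ltry.
rewrite {1}/Rintegral; congr fine.
transitivity (\int[lebesgue_measure]_(a in `[lo, hi]) \int[lebR]_z (G (a, z))%:E)%E.
  by apply: eq_integral => a ah; exact: inner.
rewrite -ge0_integral_lebR//; last 2 first.
  exact: measurable_funTS.
  by move=> a _; apply: integral_ge0 => z _; rewrite lee_fin.
rewrite integral_mkcond; apply: eq_integral => a _.
rewrite patchE mem_setE in_itv/=; case: ifPn => // /negbTE alh.
by apply/esym/integral0_eq => z _; rewrite GE alh.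
Qed.

End iterated.

(** * Comparison of the regions of integration *)

Section kernel_equation.
Context {R : realType}.
Variables (m : nat) (F : R -> R) (x : R).
Hypothesis m0 : (0 < m)%N.
Hypothesis mF : measurable_fun setT F.
Hypothesis F0 : forall z, 0 <= F z.
Hypothesis F1 : forall z, F z <= 1.
Hypothesis Fneg : forall z, z <= 0 -> F z = 0.
Hypothesis x01 : 0 <= x <= 1.

Let n : R := m.+2%:R.

(** The three kernels carry the integration limits of the theorem literally, so that
    [iterated_Rintegral] applies by [erefl]. *)
Definition kernel1 (p : R * R) : R :=
  if (pos_part (2 * x - 1) <= p.1 <= x) && (0 <= p.2 <= (1 + p.1) / 2 - x)
  then 2 * n * (n - 1) * p.1 ^+ m * F p.2 else 0.

Definition kernel2 (p : R * R) : R :=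
  if (Num.max (pos_part (x - 1 / 4)) (2 * x - 1) <= p.1 <= x) &&
     (0 <= p.2 <= Num.min (1 / 4 + p.1 - x) ((1 + p.1) / 2 - x))
  then 2 * n * (n - 1) * pos_part (3 * p.1 - 2 * x - 2 * p.2) ^+ m * F p.2 else 0.

Definition kernel3 (p : R * R) : R :=
  if (Num.max (1 / 2) (2 * x - 1) <= p.1 <= Num.max (1 / 2) x) &&
     (0 <= p.2 <= (1 + p.1) / 2 - x)
  then 4 * n * (n - 1) * (2 * p.1 - 1) ^+ m * F p.2 else 0.

(* The integrand of E[1_{A <= x} F(A + B - x)] in the variables a and
   z = a + b - x. *)
Definition shifted_kernel (p : R * R) : R :=
  if p.1 <= x then F p.2 * order_density m (p.1, p.2 + (x - p.1)) else 0.

Let n0 : 0 <= n. Proof. exact: ler0n. Qed.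

Let nE : n - 1 = m.+1%:R. Proof. by rewrite /n -natr1 addrK. Qed.

(** For [z <= 0] the factor [F] vanishes. For [z > 0] and [a <= x] the constraint [0 <= u] is
    automatic and [a <= 1 - 2 * u] reads [z <= (1 + a) / 2 - x], so [p] is the support of the
    density. The limits of the kernels differ from [p] only where a positive part to a nonzero power
    is 0. *)
Lemma shifted_kernelE p : shifted_kernel p + kernel3 p = kernel1 p + kernel2 p.
Proof.
move: p => [a z]; rewrite /shifted_kernel /kernel1 /kernel2 /kernel3 /=.
have [z0|z0] := leP z 0.
  by rewrite Fneg// !mulr0 mul0r !if_same.
have /andP[x0 x1] := x01.
have m0' : (m == 0)%N = false by rewrite gtn_eqF.
set u := z + (x - a).
pose p := (0 <= a <= x) && (z <= (1 + a) / 2 - x).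
have e0 : (if a <= x then F z * order_density m (a, u) else 0) =
    if p then F z * (2 * n * sweep_density m u a) else 0.
  rewrite /order_density /p/=; case: (leP a x) => ax; last by rewrite andbF.
  have -> : [&& 0 <= a, 0 <= u & a <= 1 - 2 * u] = (0 <= a) && (z <= (1 + a) / 2 - x).
    by rewrite /u; apply/and3P/andP => [[? ? ?]|[? ?]]; split; lra.
  by rewrite andbT; case: ifP => _; rewrite ?mulr0.
have e1 : (pos_part (2 * x - 1) <= a <= x) && (0 <= z <= (1 + a) / 2 - x) = p.
  rewrite /p (ltW z0)/= /pos_part ge_max; apply/andP/andP.
    by move=> [/andP[/andP[? ?] ?] ?]; split => //; apply/andP.
  move=> [/andP[? ?] ?]; split => //; apply/andP; split => //.
  by apply/andP; split => //; lra.
have pos_eq : 3 * a - 2 * x - 2 * z = a - 2 * u by rewrite /u; ring.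
have e2 : (if (Num.max (pos_part (x - 1 / 4)) (2 * x - 1) <= a <= x) &&
     (0 <= z <= Num.min (1 / 4 + a - x) ((1 + a) / 2 - x))
  then 2 * n * (n - 1) * pos_part (3 * a - 2 * x - 2 * z) ^+ m * F z else 0) =
  if p then 2 * n * (n - 1) * pos_part (a - 2 * u) ^+ m * F z else 0.
  rewrite pos_eq (ltW z0)/= le_min /pos_part !ge_max.
  case: (boolP p) => [/andP[/andP[a0 ax] az]|pN].
    (* If [a > 2 * u], then [a <= 1 - 2 * u] forces [u < 1 / 4], that is [z < 1 / 4 + a - x]; with
       [0 < z] this also gives [x - 1 / 4 < a]. Outside these limits the positive part is therefore
       0. *)
    case: ifPn => // cN; rewrite (_ : Num.max 0 (a - 2 * u) = 0) ?expr0n ?m0' ?mulr0 ?mul0r//.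
    apply: max_l; rewrite leNgt; apply/negP => au; move/negP: cN; apply.
    rewrite /u in au; rewrite a0 ax az/= !andbT.
    by apply/andP; split; [apply/andP; split|]; lra.
  case: ifPn => // /andP[/andP[/andP[/andP[a0 _] _] ax] /andP[_ az]].
  by move/negP: pN; case; rewrite /p a0 ax az.
have e3 : (if (Num.max (1 / 2) (2 * x - 1) <= a <= Num.max (1 / 2) x) &&
     (0 <= z <= (1 + a) / 2 - x)
  then 4 * n * (n - 1) * (2 * a - 1) ^+ m * F z else 0) =
  if p then 4 * n * (n - 1) * pos_part (2 * a - 1) ^+ m * F z else 0.
  rewrite (ltW z0)/= ge_max le_max.
  case: (boolP p) => [/andP[/andP[a0 ax] az]|pN].
    have [ah|ah] := leP (1 / 2) a.
      rewrite ax orbT az /pos_part max_r; last lra.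
      by rewrite ifT//= andbT; lra.
    by rewrite /= /pos_part max_l ?expr0n ?m0' ?mulr0 ?mul0r//; lra.
  case: ifPn => // /andP[/andP[/andP[ah _] /orP[ah'|ax]] az].
    (* The upper limit [Num.max (1 / 2) x] can admit the point [1 / 2] even when [x < 1 / 2]; the
       integrand is 0 there. *)
    have -> : a = 1 / 2 by lra.
    have -> : 2 * (1 / 2) - 1 = 0 :> R by lra.
    by rewrite expr0n m0' mulr0 mul0r.
  by move/negP: pN; case; rewrite /p ax az !andbT; lra.
rewrite [X in X + _]e0 e1 e2 e3 /sweep_density nE.
by case: ifP => _; ring.
Qed.

Let mp1 : measurable_fun setT (fun p : R * R => p.1). Proof. exact: measurable_fst. Qed.
Let mp2 : measurable_fun setT (fun p : R * R => p.2). Proof. exact: measurable_snd. Qed.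

Let m_if (c3 : R * R -> R) (l1 l2 : R) (h : R * R -> R) :
  measurable_fun setT c3 -> measurable_fun setT h ->
  measurable_fun setT (fun p : R * R =>
    if (l1 <= p.1 <= l2) && (0 <= p.2 <= c3 p) then h p else 0).
Proof.
move=> mc3 mh; apply: measurable_fun_ifT => //.
apply: measurable_and; apply: measurable_and; exact: measurable_fun_ler.
Qed.

Let m_up : measurable_fun setT (fun p : R * R => (1 + p.1) / 2 - x).
Proof. by apply: measurable_funB => //; apply: measurable_funM => //; exact: measurable_funD. Qed.

Let m_F2 : measurable_fun setT (fun p : R * R => F p.2).
Proof. exact: measurableT_comp. Qed.

Lemma measurable_kernel1 : measurable_fun setT kernel1.
Proof.
apply: (m_if (fun p => (1 + p.1) / 2 - x) _ _
  (fun p => 2 * n * (n - 1) * p.1 ^+ m * F p.2)) => //.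
by apply: measurable_funM => //; apply: measurable_funM => //; exact: measurable_funX.
Qed.

Lemma measurable_kernel2 : measurable_fun setT kernel2.
Proof.
apply: (m_if (fun p => Num.min (1 / 4 + p.1 - x) ((1 + p.1) / 2 - x)) _ _
  (fun p => 2 * n * (n - 1) * pos_part (3 * p.1 - 2 * x - 2 * p.2) ^+ m * F p.2)) => //.
  apply: measurable_minr => //.
  by apply: measurable_funB => //; exact: measurable_funD.
apply: measurable_funM => //; apply: measurable_funM => //.
apply: measurable_funX; apply: measurable_pos_part.
apply: measurable_funB; last exact: measurable_funM.
by apply: measurable_funB => //; exact: measurable_funM.
Qed.

Lemma measurable_kernel3 : measurable_fun setT kernel3.
Proof.
apply: (m_if (fun p => (1 + p.1) / 2 - x) _ _
  (fun p => 4 * n * (n - 1) * (2 * p.1 - 1) ^+ m * F p.2)) => //.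
apply: measurable_funM => //; apply: measurable_funM => //.
by apply: measurable_funX; apply: measurable_funB => //; exact: measurable_funM.
Qed.

Lemma measurable_shifted_kernel : measurable_fun setT shifted_kernel.
Proof.
apply: measurable_fun_ifT => //; first exact: measurable_fun_ler.
apply: measurable_funM => //.
apply: (measurableT_comp (measurable_order_density m)).
apply: measurable_fun_pair => //; apply: measurable_funD => //.
exact: measurable_funB.
Qed.

Let nn0 : 0 <= n * (n - 1).
Proof. by rewrite mulr_ge0// nE ler0n. Qed.

Let bound_ge0 (k v f : R) : 0 <= k -> 0 <= v -> 0 <= f -> 0 <= k * v * f.
Proof. by move=> k0 v0 f0; rewrite !mulr_ge0. Qed.

Let bound_le (k M v f : R) : 0 <= k -> k <= M -> 0 <= v <= 1 -> 0 <= f <= 1 -> k * v * f <= M.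
Proof.
move=> k0 kM /andP[v0 v1] /andP[f0 f1].
by rewrite -mulrA (le_trans _ kM)// ler_piMr// mulr_ile1.
Qed.

Let F01 z : 0 <= F z <= 1. Proof. by rewrite F0 F1. Qed.

Let k2 : 0 <= 2 * n * (n - 1). Proof. by rewrite -mulrA mulr_ge0. Qed.
Let k4 : 0 <= 4 * n * (n - 1). Proof. by rewrite -mulrA mulr_ge0. Qed.
Let k24 : 2 * n * (n - 1) <= 4 * n * (n - 1).
Proof. by rewrite -!mulrA ler_wpM2r//; lra. Qed.

Let X01 (v : R) : 0 <= v <= 1 -> 0 <= v ^+ m <= 1.
Proof. by move=> /andP[v0 v1]; rewrite exprn_ge0//= exprn_ile1. Qed.

(** One bound serves all three kernels: [4 * n * (n - 1)] is the largest prefactor, while the powers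
    and [F] stay in [[0, 1]]. *)
Lemma kernel1_bounds a z :
  0 <= kernel1 (a, z) /\
  kernel1 (a, z) <= if (0 <= a <= 1) && (0 <= z <= 1) then 4 * n * (n - 1) else 0.
Proof.
rewrite /kernel1/=; case: ifP => [/andP[/andP[a0 ax] /andP[z0 az]]|_]; last first.
  by split => //; case: ifP.
have /andP[x0 x1] := x01.
have {}a0 : 0 <= a by apply: le_trans a0; exact: pos_part_ge0.
rewrite a0 z0 (le_trans ax)//= ifT; last lra.
have /andP[v0 v1] : 0 <= a ^+ m <= 1 by apply: X01; rewrite a0 (le_trans ax).
by split; [exact: bound_ge0|apply: bound_le; rewrite ?v0].
Qed.

Lemma kernel2_bounds a z :
  0 <= kernel2 (a, z) /\
  kernel2 (a, z) <= if (0 <= a <= 1) && (0 <= z <= 1) then 4 * n * (n - 1) else 0.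
Proof.
rewrite /kernel2/= ge_max le_min.
case: ifP => [/andP[/andP[/andP[a0 _] ax] /and3P[z0 _ az]]|_]; last first.
  by split => //; case: ifP.
have /andP[x0 x1] := x01.
have {}a0 : 0 <= a by apply: le_trans a0; exact: pos_part_ge0.
rewrite a0 z0 (le_trans ax)//= ifT; last lra.
have /andP[v0 v1] : 0 <= pos_part (3 * a - 2 * x - 2 * z) ^+ m <= 1.
  by apply: X01; rewrite pos_part_ge0 /pos_part ge_max ler01/=; lra.
by split; [exact: bound_ge0|apply: bound_le; rewrite ?v0].
Qed.

Lemma kernel3_bounds a z :
  0 <= kernel3 (a, z) /\
  kernel3 (a, z) <= if (0 <= a <= 1) && (0 <= z <= 1) then 4 * n * (n - 1) else 0.
Proof.
rewrite /kernel3/= ge_max.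
case: ifP => [/andP[/andP[/andP[a0 _] ax] /andP[z0 az]]|_]; last first.
  by split => //; case: ifP.
have /andP[x0 x1] := x01.
have a1 : a <= 1 by apply: (le_trans ax); rewrite ge_max x1 andbT; lra.
have a00 : 0 <= a by lra.
rewrite a00 a1 z0 /= ifT; last lra.
have /andP[v0 v1] : 0 <= (2 * a - 1) ^+ m <= 1 by apply: X01; apply/andP; split; lra.
by split; [exact: bound_ge0|apply: bound_le; rewrite ?v0].
Qed.

Lemma shifted_kernel_ge0 p : 0 <= shifted_kernel p.
Proof.
by rewrite /shifted_kernel; case: ifP => // _; rewrite mulr_ge0// order_density_ge0.
Qed.

Local Open Scope ereal_scope.

Lemma integral_order_law :
  \int[order_law m]_(p in [set p : R * R | (p.1 <= x)%R]) (F (p.1 + p.2 - x))%:E =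
  \int[lebR]_a \int[lebR]_z (shifted_kernel (a, z))%:E.
Proof.
set D := [set p : R * R | _].
have mD : measurable D by apply: measurable_ler_set.
pose g (p : R * R) := (F (p.1 + p.2 - x))%R.
have mg : measurable_fun setT g.
  apply: measurableT_comp => //; apply: measurable_funB => //.
  exact: measurable_funD.
have mgD : measurable_fun setT ((EFin \o g) \_ D).
  by apply: (measurable_restrictT _ mD).1; apply: measurable_funTS; exact/measurable_EFinP.
have mod : measurable_fun setT (EFin \o @order_density R m).
  by apply/measurable_EFinP; exact: measurable_order_density.
have gD0 p : 0 <= ((EFin \o g) \_ D) p.
  by rewrite patchE; case: ifP => // _; rewrite /= lee_fin; exact: F0.
rewrite integral_mkcond ge0_integral_density_measure//.
rewrite fubini_tonelli1/=; last 2 first.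
- exact: emeasurable_funM mgD mod.
- by move=> p; rewrite mule_ge0// lee_fin order_density_ge0.
apply: eq_integral => a _; rewrite /fubini_F.
pose k (t : R) := ((EFin \o g) \_ D) (a, t) * (order_density m (a, t))%:E.
rewrite -(@lebR_shift _ (x - a)%R k).
- apply: eq_integral => z _; rewrite /k patchE /shifted_kernel/=.
  have -> : ((a, z + (x - a))%R \in D) = (a <= x)%R.
    by apply/idP/idP => [/set_mem//|ax]; exact: mem_set.
  case: ifP => _; last by rewrite mul0e.
  by rewrite /= /g/= -EFinM; congr (F _ * _)%:E; ring.
- apply: emeasurable_funM; first exact: measurable_fun_pair2.
  exact: (measurable_fun_pair2 _ mod).
- by move=> t; rewrite /k mule_ge0// lee_fin order_density_ge0.
Qed.

Let II (G : R * R -> R) := \int[lebR]_a \int[lebR]_z (G (a, z))%:E.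

Let II_add (G H : R * R -> R) : measurable_fun setT G -> measurable_fun setT H ->
  (forall p, 0 <= G p)%R -> (forall p, 0 <= H p)%R ->
  II (fun p : R * R => G p + H p)%R = II G + II H.
Proof.
move=> mG mH G0 H0.
have mII (K : R * R -> R) : measurable_fun setT K -> (forall p, 0 <= K p)%R ->
    measurable_fun setT (fun a => \int[lebR]_z (K (a, z))%:E).
  move=> mK K0; apply: (@measurable_fun_fubini_tonelli_F _ _ _ _ _ (@lebR R) (EFin \o K)).
    exact/measurable_EFinP.
  by move=> p; rewrite lee_fin.
have sec (K : R * R -> R) a : measurable_fun setT K -> measurable_fun setT (fun z => (K (a, z))%:E).
  by move=> mK; apply/measurable_EFinP; exact: measurable_fun_pair2.
rewrite /II -ge0_integralD//.
- apply: eq_integral => a _; rewrite -ge0_integralD//.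
  + by move=> z _; rewrite lee_fin.
  + exact: sec.
  + by move=> z _; rewrite lee_fin.
  + exact: sec.
- by move=> a _; apply: integral_ge0 => z _; rewrite lee_fin.
- exact: mII.
- by move=> a _; apply: integral_ge0 => z _; rewrite lee_fin.
- exact: mII.
Qed.

(** The subtracted integral stands on the left, so that additivity for nonnegative functions applies
    on both sides. *)
Lemma integral_kernelE :
  II shifted_kernel + II kernel3 = II kernel1 + II kernel2.
Proof.
have k10 p : (0 <= kernel1 p)%R by case: p => a z; have [] := kernel1_bounds a z.
have k20 p : (0 <= kernel2 p)%R by case: p => a z; have [] := kernel2_bounds a z.
have k30 p : (0 <= kernel3 p)%R by case: p => a z; have [] := kernel3_bounds a z.
rewrite -(II_add _ _ measurable_kernel1 measurable_kernel2 k10 k20).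
rewrite -(II_add _ _ measurable_shifted_kernel measurable_kernel3 shifted_kernel_ge0 k30).
rewrite /II; apply: eq_integral => a _; apply: eq_integral => z _.
by rewrite shifted_kernelE.
Qed.

Lemma kernel_equation :
  \int[order_law m]_(p in [set p : R * R | (p.1 <= x)%R]) (F (p.1 + p.2 - x))%:E =
  (\int[lebesgue_measure]_(a in `[pos_part (2 * x - 1), x])
     \int[lebesgue_measure]_(z in `[0, (1 + a) / 2 - x])
       (2 * n * (n - 1) * a ^+ m * F z)
   + \int[lebesgue_measure]_(a in `[Num.max (pos_part (x - 1 / 4)) (2 * x - 1), x])
       \int[lebesgue_measure]_(z in `[0, Num.min (1 / 4 + a - x) ((1 + a) / 2 - x)])
         (2 * n * (n - 1) * pos_part (3 * a - 2 * x - 2 * z) ^+ m * F z)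
   - \int[lebesgue_measure]_(a in `[Num.max (1 / 2) (2 * x - 1), Num.max (1 / 2) x])
       \int[lebesgue_measure]_(z in `[0, (1 + a) / 2 - x])
         (4 * n * (n - 1) * (2 * a - 1) ^+ m * F z))%R%:E.
Proof.
have k10 p : (0 <= kernel1 p)%R by case: p => a z; have [] := kernel1_bounds a z.
have k20 p : (0 <= kernel2 p)%R by case: p => a z; have [] := kernel2_bounds a z.
have k30 p : (0 <= kernel3 p)%R by case: p => a z; have [] := kernel3_bounds a z.
have k1M a z := (kernel1_bounds a z).2.
have k2M a z := (kernel2_bounds a z).2.
have k3M a z := (kernel3_bounds a z).2.
have f1 := iterated_integral_fin_num _ _ measurable_kernel1 k10 k1M.
have f2 := iterated_integral_fin_num _ _ measurable_kernel2 k20 k2M.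
have f3 := iterated_integral_fin_num _ _ measurable_kernel3 k30 k3M.
have r1 := iterated_Rintegral _ _ measurable_kernel1 k10 k1M (pos_part (2 * x - 1))%R x
  (fun a => (1 + a) / 2 - x)%R (fun a z => 2 * n * (n - 1) * a ^+ m * F z)%R
  (fun a z => erefl).
have r2 := iterated_Rintegral _ _ measurable_kernel2 k20 k2M
  (Num.max (pos_part (x - 1 / 4)) (2 * x - 1))%R x
  (fun a => Num.min (1 / 4 + a - x) ((1 + a) / 2 - x))%R
  (fun a z => 2 * n * (n - 1) * pos_part (3 * a - 2 * x - 2 * z) ^+ m * F z)%R
  (fun a z => erefl).
have r3 := iterated_Rintegral _ _ measurable_kernel3 k30 k3M
  (Num.max (1 / 2) (2 * x - 1))%R (Num.max (1 / 2) x)%R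
  (fun a => (1 + a) / 2 - x)%R (fun a z => 4 * n * (n - 1) * (2 * a - 1) ^+ m * F z)%R
  (fun a z => erefl).
(* Finiteness of the three kernel integrals permits the subtraction. *)
have solve (u v w t : \bar R) : u \is a fin_num -> v \is a fin_num -> w \is a fin_num ->
    t + w = u + v -> t = (fine u + fine v - fine w)%:E.
  by move=> fu fv fw tw; rewrite EFinB EFinD !fineK// -tw addeK.
rewrite integral_order_law r1 r2 r3.
exact: (solve _ _ _ _ f1 f2 f3 integral_kernelE).
Qed.

End kernel_equation.

Theorem lemma3 (R : realType) (n : nat) (hn : (3 <= n)%N)
  (* a generic order: item positions, preparation time, pick time *)
  (d1 : measure_display) (T1 : measurableType d1) (P1 : probability T1 R)
  (X : 'I_n -> {RV P1 >-> R})
  (X_indep : mutually_independent X)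
  (X_unif : forall i, uniform_on_circle (X i))
  (A B : {RV P1 >-> R})
  (A_def : forall w, A w = pick_time (fun i => X i w))
  (B_def : forall w, B w = preparation_time (fun i => X i w))
  (* the successive orders and their sojourn times *)
  (d2 : measure_display) (T2 : measurableType d2) (P2 : probability T2 R)
  (AB : nat -> {RV P2 >-> (R * R)%type})
  (AB_indep : mutually_independent AB)
  (AB_copy : forall k (E : set (R * R)), measurable E ->
    distribution P2 (AB k) E = P1 [set w | E (A w, B w)])
  (Sk : nat -> {RV P2 >-> R})
  (S_init : forall w, Sk 0%N w = (AB 0%N w).2 + (AB 0%N w).1)
  (S_rec : forall k w,
    Sk k.+1 w = pos_part ((AB k.+1 w).2 - Sk k w) + (AB k.+1 w).1)
  (* the steady-state sojourn time *)
  (d3 : measure_display) (T3 : measurableType d3) (P3 : probability T3 R)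
  (S : {RV P3 >-> R})
  (S_lim : cvg_in_distribution Sk S)
  (S_01 : {ae P3, forall w, 0 <= S w <= 1})
  (S_0 : distr_fun S 0 = 0)
  (S_dens : has_density S)
  (x : R) (hx : 0 <= x <= 1) :
  distr_fun S x =
    distr_fun A x
    - \int[lebesgue_measure]_(y in `[pos_part (2 * x - 1), x])
        \int[lebesgue_measure]_(z in `[0, (1 + y) / 2 - x])
          (2 * n%:R * (n%:R - 1) * y ^+ (n - 2) * distr_fun S z)
    - \int[lebesgue_measure]_(y in
          `[Num.max (pos_part (x - 1 / 4)) (2 * x - 1), x])
        \int[lebesgue_measure]_(z in
            `[0, Num.min (1 / 4 + y - x) ((1 + y) / 2 - x)])
          (2 * n%:R * (n%:R - 1)
           * pos_part (3 * y - 2 * x - 2 * z) ^+ (n - 2) * distr_fun S z)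
    + \int[lebesgue_measure]_(y in
          `[Num.max (1 / 2) (2 * x - 1), Num.max (1 / 2) x])
        \int[lebesgue_measure]_(z in `[0, (1 + y) / 2 - x])
          (4 * n%:R * (n%:R - 1) * (2 * y - 1) ^+ (n - 2) * distr_fun S z).
Proof.
(* With [n = m.+2] the assumption [3 <= n] becomes [0 < m], where [m] is the exponent [n - 2]. *)
case: n hn X X_indep X_unif A_def B_def => [//|[//|m]] m0 X X_indep X_unif A_def B_def.
rewrite !subSS subn0.
pose law := distribution P2 (AB 0%N).
have lawE E : measurable E -> law E = order_law m E.
  by move=> mE; rewrite /law AB_copy// (order_distribution X).
have AB_law k E : measurable E -> distribution P2 (AB k) E = law E.
  by move=> mE; rewrite /law !AB_copy.
have Fneg z : z <= 0 -> distr_fun S z = 0.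
  move=> z0; apply/le_anti; rewrite distr_fun_ge0 andbT -S_0.
  exact: distr_fun_nondecreasing.
have st := stationary_equation law AB Sk S AB_indep AB_law S_init S_rec S_lim
  (has_density_continuous S S_dens) x.
set D := [set p : R * R | p.1 <= x] in st.
have mD : measurable D by apply: measurable_ler_set => //; exact: measurable_fst.
(* [F_A] enters as the mass of the half plane [D] under the law of an order. *)
have lawD : law D = (distr_fun A x)%:E.
  by rewrite EFin_distr_fun /law AB_copy.
have lawI : (\int[law]_(p in D) (distr_fun S (p.1 + p.2 - x))%:E =
             \int[order_law m]_(p in D) (distr_fun S (p.1 + p.2 - x))%:E)%E.
  by apply: eq_measure_integral => E mE _; exact: lawE.
have ke := kernel_equation m (distr_fun S) x m0 (measurable_distr_fun S)
  (distr_fun_ge0 S) (distr_fun_le1 S) Fneg hx.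
have : ((distr_fun S x)%:E + \int[order_law m]_(p in D)
    (distr_fun S (p.1 + p.2 - x))%:E = (distr_fun A x)%:E)%E.
  by apply: etrans lawD; apply: etrans st; congr (_ + _)%E; exact/esym.
rewrite ke -EFinD => -[<-].
have alg (f u v w : R) : f = f + (u + v - w) - u - v + w by ring.
exact: alg.
Qed.
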